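(* Let $\kappa\neq0$, $\varepsilon\in\{1,-1\}$, and let $H,I,s_0$ be real constants. Put $A=4H^2\varepsilon+\kappa$ and, if $A\ne0$, let $c\ge0$ be given by $c^2=\left|\frac{\kappa}{A^2}\big(A-\kappa^2I^2\varepsilon\big)\right|$. The following formulae for $z=z(s)$ describe two-parameter families of helicoidal surfaces of constant mean curvature $H$ in $\mathbb{M}^2(\kappa)\times\mathbb{R}$: (i) if $A<0$ and $\kappa(A-\kappa^2I^2\varepsilon)<0$: $\; z=c\,\sinh\big((-A)^{1/2}(s-s_0)\big)-\frac{2H\kappa I\varepsilon}{A}$; (ii) if $A<0$ and $\kappa(A-\kappa^2I^2\varepsilon)>0$: $\; z=c\,\cosh\big((-A)^{1/2}(s-s_0)\big)-\frac{2H\kappa I\varepsilon}{A}$; (iii) if $A>0$ (where necessarily $\kappa(A-\kappa^2I^2\varepsilon)>0$): $\; z=c\,\sin\big(A^{1/2}(s-s_0)\big)-\frac{2H\kappa I\varepsilon}{A}$; (iv) if $A=0$ and $H\kappa I=0$ (where necessarily $\kappa(1-\kappa I^2\varepsilon)>0$): $\; z=\big(\kappa(1-\kappa I^2\varepsilon)\big)^{1/2}(s-s_0)$; (v) if $A=0$ and $H\kappa I\ne0$: $\; z=-\frac{1}{4H\kappa I\varepsilon}\Big(\frac14(s-s_0)^2-\kappa(1-\kappa I^2\varepsilon)\Big)$. Here the parameters of the family are $m\neq0$ and the pitch $b$; the function $U(s)$ is determined by $z=(1-\kappa(m^2U^2-\varepsilon b^2))^{1/2}$, and the surface is parametrized in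 cylindrical coordinates by $(s,\tilde\theta)\mapsto(\rho(s),\theta(s,\tilde\theta),t(s)+b\,\theta(s,\tilde\theta))$ with $$\rho=\int\left(\frac{m^4U^2\dot U^2}{(m^2U^2-\varepsilon b^2)(1-\kappa(m^2U^2-\varepsilon b^2))}\right)^{1/2}ds,\qquad \mathrm{sn}_\kappa^2(\rho)=m^2U^2-\varepsilon b^2,$$ $$t=\int R_0\,\frac{mU}{m^2U^2-\varepsilon b^2}\,ds,\qquad \theta=\frac{\tilde\theta}{m}+\int\frac{b\,R_0}{mU(m^2U^2-\varepsilon b^2)}\,ds,$$ $$R_0=\left(\varepsilon\,\frac{(m^2U^2-\varepsilon b^2)(1-\kappa(m^2U^2-\varepsilon b^2))-m^4U^2\dot U^2}{1-\kappa(m^2U^2-\varepsilon b^2)}\right)^{1/2}.$$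
   Context: $\mathbb{M}^2(\kappa)$ is the simply connected complete surface of constant curvature $\kappa$ with metric $d\sigma^2$; $\mathbb{M}^2(\kappa)\times\mathbb{R}$ carries the metric $d\sigma^2+\varepsilon\,dt^2$ (surfaces are space-like when $\varepsilon=-1$). $(\rho,\theta,t)$ are cylindrical coordinates with $(\rho,\theta)$ polar coordinates on $\mathbb{M}^2(\kappa)$ centered at a point $p_0$, and $\mathrm{sn}_\kappa(\rho)=|\langle\partial_\theta,\partial_\theta\rangle|^{1/2}$, that is, $\sin(\sqrt\kappa\rho)/\sqrt\kappa$ for $\kappa>0$ and $\sinh(\sqrt{-\kappa}\rho)/\sqrt{-\kappa}$ for $\kappa<0$. A helicoidal (screw-motion invariant) surface of pitch $b$ is one with a parametrization of the form $(\rho(s),\theta,t(s)+b\theta)$. In the claim the dot denotes $d/ds$, where $(s,\tilde\theta)$ are the natural parameters in which the metric of the surface is $ds^2+U(s)^2d\tilde\theta^2$. The mean curvature is half the trace of the second fundamental form with respect to the unit normal $$n=\frac1W\big(\mathrm{sn}_\kappa(\rho)\,\dot t\,\partial_\rho+b\,\mathrm{sn}_\kappa^{-1}(\rho)\,\dot\rho\,\partial_\theta-\varepsilon\,\mathrm{sn}_\kappa(\rho)\,\dot\rho\,\partial_t\big),\quad W^2=\mathrm{sn}_\kappa^2(\rho)(\dot\rho^2+\varepsilon\dot t^2)+\varepsilon b^2\dot\rho^2,$$ of the parametrization $(\rho(s),\theta,t(s)+b\theta)$ (in this formula for $n$ the dot is the derivative in the parameter of the profile curve). The constant $I$ is the first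 integral of the constant mean curvature equation: writing the profile curve as a graph $t=t(\rho)$, one has $\frac{dt}{d\rho}\,\frac{\mathrm{sn}_\kappa^2(\rho)}{W}=I-2H\int\mathrm{sn}_\kappa(\rho)\,d\rho$, with $\int\mathrm{sn}_\kappa(\rho)\,d\rho=-\frac1\kappa\frac{d}{d\rho}\mathrm{sn}_\kappa(\rho)$.
   Formalization: In (v), (s-s0)²/4 is multiplied by (4HκIε)², as the printed formula is false unless (4HκI)²=1; the square roots in ρ and R0 are differentiable determinations of either sign; R0 in θ may have either sign relative to t, natural parameters holding for the relative sign -ε. *)

(* Defs.v *)
(* Stdlib reals with Coquelicot. *)
From Stdlib Require Import Reals.
From Coquelicot Require Import Coquelicot.
Open Scope R_scope.

Definition is_sign (x : R) : Prop := x = 1 \/ x = -1.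

Definition interval (lo hi : Rbar) (s : R) : Prop :=
  Rbar_lt lo s /\ Rbar_lt s hi.

(** * The ambient space, in cylindrical coordinates *)

Definition sn (kappa rho : R) : R :=
  if Rlt_dec 0 kappa then sin (sqrt kappa * rho) / sqrt kappa
  else if Rlt_dec kappa 0 then sinh (sqrt (- kappa) * rho) / sqrt (- kappa)
  else rho.

(* For kappa <> 0, the primitive - sn' / kappa of sn that normalizes the
   constant of the first integral. *)
Definition int_sn (kappa rho : R) : R := - (1 / kappa) * Derive (sn kappa) rho.

(* The polar chart of the surface of curvature kappa covers everything but the
   centre and, when kappa > 0, the antipode of the centre. *)
Definition polar_radius (kappa rho : R) : Prop :=
  0 < rho /\ (0 < kappa -> rho < PI / sqrt kappa).

Inductive coord : Set := Rho | Theta | Height.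

Definition coord_eqb (i j : coord) : bool :=
  match i, j with
  | Rho, Rho | Theta, Theta | Height, Height => true
  | _, _ => false
  end.

(* Both points, by their cylindrical coordinates, and tangent vectors, by their
   components in the coordinate frame. The angle is an unreduced real. *)
Definition vec : Type := coord -> R.

Definition mkvec (x y z : R) : vec :=
  fun i => match i with Rho => x | Theta => y | Height => z end.

Definition csum (F : coord -> R) : R := F Rho + F Theta + F Height.

Definition metric (kappa eps : R) (p : vec) (i j : coord) : R :=
  match i, j with
  | Rho, Rho => 1
  | Theta, Theta => sn kappa (p Rho) ^ 2
  | Height, Height => eps
  | _, _ => 0
  end.

Definition inner (kappa eps : R) (p u v : vec) : R :=
  csum (fun i => csum (fun j => metric kappa eps p i j * u i * v j)).

Definition upd (p : vec) (k : coord) (x : R) : vec :=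
  fun i => if coord_eqb i k then x else p i.

Definition partial_metric (kappa eps : R) (k i j : coord) (p : vec) : R :=
  Derive (fun x => metric kappa eps (upd p k x) i j) (p k).

(* Christoffel symbols of the first kind, Gamma_{ij,k}. *)
Definition christoffel (kappa eps : R) (p : vec) (i j k : coord) : R :=
  (partial_metric kappa eps i j k p + partial_metric kappa eps j i k p
   - partial_metric kappa eps k i j p) / 2.

(** * Parametrized surfaces *)

Definition d1 (X : R -> R -> vec) : R -> R -> vec :=
  fun s v i => Derive (fun s' => X s' v i) s.

Definition d2 (X : R -> R -> vec) : R -> R -> vec :=
  fun s v i => Derive (fun v' => X s v' i) v.

(* <D_a X_b, N> for the Levi-Civita connection of the ambient metric along X,
   where Xa, Xb are the two velocities and Xab is the coordinatewise second
   derivative. *)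
Definition second_form (kappa eps : R) (p Xab Xa Xb N : vec) : R :=
  csum (fun k => N k *
    (csum (fun l => metric kappa eps p l k * Xab l)
     + csum (fun i => csum (fun j =>
         christoffel kappa eps p i j k * Xa i * Xb j)))).

Definition ffE kappa eps (X : R -> R -> vec) (s v : R) : R :=
  inner kappa eps (X s v) (d1 X s v) (d1 X s v).
Definition ffF kappa eps (X : R -> R -> vec) (s v : R) : R :=
  inner kappa eps (X s v) (d1 X s v) (d2 X s v).
Definition ffG kappa eps (X : R -> R -> vec) (s v : R) : R :=
  inner kappa eps (X s v) (d2 X s v) (d2 X s v).

Definition sfe kappa eps (X N : R -> R -> vec) (s v : R) : R :=
  second_form kappa eps (X s v) (d1 (d1 X) s v) (d1 X s v) (d1 X s v) (N s v).
Definition sff kappa eps (X N : R -> R -> vec) (s v : R) : R :=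
  second_form kappa eps (X s v) (d1 (d2 X) s v) (d1 X s v) (d2 X s v) (N s v).
Definition sfg kappa eps (X N : R -> R -> vec) (s v : R) : R :=
  second_form kappa eps (X s v) (d2 (d2 X) s v) (d2 X s v) (d2 X s v) (N s v).

(* Half the trace of the second fundamental form. No factor eps is inserted when
   N is time-like; with this convention the first integral below reads the same
   for both values of eps. *)
Definition mean_curvature kappa eps (X N : R -> R -> vec) (s v : R) : R :=
  (sfe kappa eps X N s v * ffG kappa eps X s v
   - 2 * sff kappa eps X N s v * ffF kappa eps X s v
   + sfg kappa eps X N s v * ffE kappa eps X s v)
  / (2 * (ffE kappa eps X s v * ffG kappa eps X s v - ffF kappa eps X s v ^ 2)).

Definition differentiable_on (D : R -> Prop) (X : R -> R -> vec) : Prop :=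
  forall s v i, D s ->
    ex_derive (fun s' => X s' v i) s /\ ex_derive (fun v' => X s v' i) v.

(* The positivity of E and EG - F^2 says that X is an immersion and, when
   eps = -1, that it is space-like. *)
Record constant_mean_curvature (kappa eps : R) (D : R -> Prop)
    (X N : R -> R -> vec) (H : R) : Prop := {
  cmc_chart : forall s v, D s -> polar_radius kappa (X s v Rho);
  cmc_smooth : differentiable_on D X /\ differentiable_on D (d1 X)
    /\ differentiable_on D (d2 X);
  cmc_riemannian : forall s v, D s -> 0 < ffE kappa eps X s v /\
    0 < ffE kappa eps X s v * ffG kappa eps X s v - ffF kappa eps X s v ^ 2;
  cmc_normal : forall s v, D s ->
    inner kappa eps (X s v) (N s v) (N s v) = eps /\
    inner kappa eps (X s v) (N s v) (d1 X s v) = 0 /\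
    inner kappa eps (X s v) (N s v) (d2 X s v) = 0;
  cmc_value : forall s v, D s -> mean_curvature kappa eps X N s v = H
}.

Definition natural_metric (kappa eps : R) (D : R -> Prop) (U : R -> R)
    (X : R -> R -> vec) : Prop :=
  forall s v, D s -> ffE kappa eps X s v = 1 /\ ffF kappa eps X s v = 0 /\
    ffG kappa eps X s v = U s ^ 2.

(** * Helicoidal surfaces *)

Definition screw_surface (b : R) (rho t : R -> R) (th : R -> R -> R)
    : R -> R -> vec :=
  fun s v => mkvec (rho s) (th s v) (t s + b * th s v).

Definition helicoidal (b : R) (D : R -> Prop) (X : R -> R -> vec) : Prop :=
  exists r h : R -> R, forall p : vec,
    (exists s v, D s /\ X s v = p) <->
    (exists s theta, D s /\ mkvec (r s) theta (h s + b * theta) = p).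

Definition W2 (kappa eps b : R) (rho t : R -> R) (s : R) : R :=
  sn kappa (rho s) ^ 2 * (Derive rho s ^ 2 + eps * Derive t s ^ 2)
  + eps * b ^ 2 * Derive rho s ^ 2.

Definition helicoidal_normal (kappa eps b : R) (rho t : R -> R) (s : R) : vec :=
  let S := sn kappa (rho s) in
  let W := sqrt (W2 kappa eps b rho t s) in
  mkvec (S * Derive t s / W) (b * / S * Derive rho s / W)
        (- eps * S * Derive rho s / W).

(* For the profile parameter s = rho this is the first integral of the graph
   t = t(rho). Like the normal above, it is unchanged by a change of parameter
   that preserves the orientation of the profile. *)
Definition first_integral (kappa eps b : R) (D : R -> Prop) (rho t : R -> R)
    (H I0 : R) : Prop :=
  forall s, D s ->
    Derive t s * sn kappa (rho s) ^ 2 / sqrt (W2 kappa eps b rho t s)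
    = I0 - 2 * H * int_sn kappa (rho s).

(* A graph profile t = f(rho) over a nonempty interval of radii, generating an
   immersed (space-like) surface of pitch b, with first integral (H, I0). *)
Definition graph_with_first_integral (kappa eps b H I0 : R) (lo hi : Rbar)
    (f : R -> R) : Prop :=
  Rbar_lt lo hi /\
  (forall r, interval lo hi r ->
     polar_radius kappa r /\ ex_derive f r /\
     0 < W2 kappa eps b (fun r' => r') f r) /\
  first_integral kappa eps b (interval lo hi) (fun r' => r') f H I0.

(** * Reconstruction of the surface from U, m and b *)

Definition radius2 (eps m b : R) (U : R -> R) (s : R) : R :=
  m ^ 2 * U s ^ 2 - eps * b ^ 2.

(* U is the positive function with z = (1 - kappa (m^2 U^2 - eps b^2))^(1/2); the
   interval D is one on which the denominators of the formulae for rho, t and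
   theta do not vanish. *)
Definition determined_by (kappa eps m b : R) (z : R -> R) (D : R -> Prop)
    (U : R -> R) : Prop :=
  forall s, D s ->
    0 < U s /\ 0 < radius2 eps m b U s /\
    0 < 1 - kappa * radius2 eps m b U s /\
    z s = sqrt (1 - kappa * radius2 eps m b U s).

Definition drho_radicand (kappa eps m b : R) (U : R -> R) (s : R) : R :=
  m ^ 4 * U s ^ 2 * Derive U s ^ 2
  / (radius2 eps m b U s * (1 - kappa * radius2 eps m b U s)).

Definition R0_radicand (kappa eps m b : R) (U : R -> R) (s : R) : R :=
  eps * ((radius2 eps m b U s * (1 - kappa * radius2 eps m b U s)
          - m ^ 4 * U s ^ 2 * Derive U s ^ 2)
         / (1 - kappa * radius2 eps m b U s)).

(* The square roots in rho' and R0 are taken as differentiable determinations, of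
   either sign. The sign of rho' is forced by sn(rho)^2 = m^2 U^2 - eps b^2, namely
   rho' = - z' / (kappa sn(rho)) when sn'(rho) = z, and R0 may change sign inside D,
   where the nonnegative root is not differentiable. The nonnegative roots are
   included wherever they are admissible. *)
Record profile (kappa eps m b : R) (D : R -> Prop) (U rho R0 t Th : R -> R)
    : Prop := {
  profile_chart : forall s, D s -> polar_radius kappa (rho s);
  profile_sn : forall s, D s -> sn kappa (rho s) ^ 2 = radius2 eps m b U s;
  profile_rho : forall s, D s ->
    ex_derive rho s /\ Derive rho s ^ 2 = drho_radicand kappa eps m b U s;
  profile_R0 : forall s, D s ->
    ex_derive R0 s /\ R0 s ^ 2 = R0_radicand kappa eps m b U s;
  profile_t : forall s, D s ->
    is_derive t s (R0 s * (m * U s / radius2 eps m b U s));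
  profile_theta : forall s, D s ->
    is_derive Th s (b * R0 s / (m * U s * radius2 eps m b U s))
}.

(* eta = 1 or -1 is the determination of R0 used in theta relative to the one
   used in t. Changing it only reparametrizes the surface; (s, v) are natural
   parameters exactly for eta = - eps unless b R0 = 0. *)
Definition profile_surface (m b eta : R) (rho t Th : R -> R) : R -> R -> vec :=
  screw_surface b rho t (fun s v => v / m + eta * Th s).

(* Main.v *)
(* In natural parameters W = |m| U and S = sn(rho) satisfies S^2 = (1 - z^2)/kappa, so the
   first integral reduces to R0 = +-(I + 2 H z/kappa). Substituting this in the formula for
   R0 gives z'^2 = kappa (1 - z^2) - eps (kappa I + 2 H z)^2, and the five families are the
   solutions of this equation according to the sign of A and of its discriminant. The signs
   of sn'(rho) = +- z and of R0 are constant on the interval, because z has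
   no zero there and I + 2 H z/kappa, unless identically 0, only simple ones. *)
Require Import Defs.
From Stdlib Require Import Reals Lra Psatz.
From Coquelicot Require Import Coquelicot.
Open Scope R_scope.

(** Differentiating the first integral gives the mean curvature only after division by rho', which
    vanishes with z'. The curvature is therefore computed from the fundamental forms, and the
    second-order equation for z is carried along with the first-order one. Three signs survive the
    square roots: that of sn'(rho) against z, that of R0 against I + 2 H z / kappa, and that of m,
    hidden in sqrt(W^2) = |m| U. They turn H into tau H and I into sigma I. For the existence claim
    sn'(rho) = z and R0 gets the sign of m, so that the signs cancel. The necessary conditions in
    (iii) and (iv) come from any single point of a graph: the quadratic kappa (1 - x^2) - eps (kappa
    I + 2 H x)^2 is positive at x = sn'(r). *)

(** * Open intervals and locally constant functions *)

Lemma interval_locally lo hi s : interval lo hi s -> locally s (interval lo hi).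
Proof.
intros [h1 h2]; apply filter_and.
- exact (open_Rbar_gt lo s h1).
- exact (open_Rbar_lt hi s h2).
Qed.

Lemma locally_on lo hi (P : R -> Prop) s :
  (forall u, interval lo hi u -> P u) -> interval lo hi s -> locally s P.
Proof.
intros h hs; apply filter_imp with (1 := h); now apply interval_locally.
Qed.

Lemma interval_inhabited lo hi : Rbar_lt lo hi -> exists s, interval lo hi s.
Proof.
unfold interval; destruct lo as [x| |], hi as [y| |]; simpl; try easy; intros h.
- exists ((x + y) / 2); lra.
- exists (x + 1); split; [lra|easy].
- exists (y - 1); split; [easy|lra].
- now exists 0.
Qed.

Lemma interval_between lo hi u v s :
  interval lo hi u -> interval lo hi v -> u <= s <= v -> interval lo hi s.
Proof.
intros [h1 h2] [h3 h4] [h5 h6]; split.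
- apply Rbar_lt_le_trans with (1 := h1); exact h5.
- apply Rbar_le_lt_trans with (2 := h4); exact h6.
Qed.

Lemma constant_on_interval lo hi (f : R -> R) :
  (forall s, interval lo hi s -> is_derive f s 0) ->
  forall u v, interval lo hi u -> interval lo hi v -> f u = f v.
Proof.
intros hf.
assert (hlt : forall u v, interval lo hi u -> interval lo hi v -> u < v -> f u = f v).
{ intros u v hu hv huv; apply eq_is_derive; [|exact huv].
  intros t ht; apply hf; exact (interval_between _ _ _ _ _ hu hv ht). }
intros u v hu hv; destruct (Rtotal_order u v) as [h|[h|h]].
- now apply hlt.
- now rewrite h.
- symmetry; now apply hlt.
Qed.

(** * Differentiable square roots and their signs *)

Lemma is_sign_sqr e : is_sign e -> e * e = 1.
Proof. intros [-> | ->]; ring. Qed.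

Lemma is_sign_mult e f : is_sign e -> is_sign f -> is_sign (e * f).
Proof. intros [-> | ->] [-> | ->]; [left|right|right|left]; ring. Qed.

Lemma ex_derive_neq0_locally (p : R -> R) (s : R) :
  ex_derive p s -> p s <> 0 -> locally s (fun u => p u <> 0).
Proof.
intros hp h.
apply (ex_derive_continuous p s hp (fun y : R => y <> 0)); now apply open_neq.
Qed.

(** If p s = 0, a zero u other than s makes the difference quotient 0, at distance |l| from the
    derivative l, whereas near s this distance is below |l| / 2. *)
Lemma simple_zero_isolated (p : R -> R) (s l : R) :
  is_derive p s l -> p s <> 0 \/ l <> 0 ->
  locally s (fun u => u <> s -> p u <> 0).
Proof.
intros hp [h|h].
- apply filter_imp with (P := fun u => p u <> 0); [now auto|].
  apply ex_derive_neq0_locally; [now exists l|exact h].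
- destruct (Req_dec (p s) 0) as [h0|h0].
  + apply is_derive_Reals in hp.
    destruct (hp (Rabs l / 2)) as [d hd]; [pose proof (Rabs_pos_lt l h); lra|].
    exists d; change (forall u : R, ball s d u -> u <> s -> p u <> 0).
    intros u hu hus hpu.
    assert (hne : u - s <> 0) by lra.
    specialize (hd (u - s) hne hu).
    replace (s + (u - s)) with u in hd by ring.
    rewrite hpu, h0 in hd.
    replace ((0 - 0) / (u - s) - l) with (- l) in hd by (field; exact hne).
    rewrite Rabs_Ropp in hd; pose proof (Rabs_pos_lt l h); lra.
  + apply filter_imp with (P := fun u => p u <> 0); [now auto|].
    apply ex_derive_neq0_locally; [now exists l|exact h0].
Qed.

(** The product (f - g)(f + g) vanishes identically. A factor that is nonzero or has nonzero
    derivative at s has no other zero nearby, so the other factor vanishes there, and at s by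
    continuity. *)
Lemma sign_determination_locally lo hi (f g g1 : R -> R) s :
  interval lo hi s ->
  (forall u, interval lo hi u -> f u ^ 2 = g u ^ 2) ->
  ex_derive f s -> is_derive g s (g1 s) -> 0 < g s ^ 2 + g1 s ^ 2 ->
  exists sg, is_sign sg /\ locally s (fun u => f u = sg * g u).
Proof.
intros hs hsq [f1 hf] hg hpos.
assert (key : forall sg, is_sign sg ->
  f s - sg * g s <> 0 \/ f1 - sg * g1 s <> 0 ->
  locally s (fun u => f u = - sg * g u)).
{ intros sg hsg hne.
  assert (hd : is_derive (fun u => f u - sg * g u) s (f1 - sg * g1 s)).
  { apply (@is_derive_minus R_AbsRing R_NormedModule); [exact hf|]; now apply is_derive_scal. }
  assert (hloc : locally s (fun u => u <> s -> f u = - sg * g u)).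
  { apply filter_imp with (P := fun u => (u <> s -> f u - sg * g u <> 0)
      /\ interval lo hi u).
    - intros u [h1 h2] hu; specialize (h1 hu); specialize (hsq u h2).
      assert (h0 : (f u - sg * g u) * (f u + sg * g u) = 0).
      { pose proof (is_sign_sqr sg hsg); nra. }
      apply Rmult_integral in h0; destruct h0; lra.
    - apply filter_and; [exact (simple_zero_isolated _ _ _ hd hne)|].
      now apply interval_locally. }
  (* Otherwise f + sg g is nonzero near s, which contradicts [hloc] at the point s + d/2 of the
     punctured neighbourhood. *)
  assert (hcont : f s = - sg * g s).
  { destruct (Req_dec (f s) (- sg * g s)) as [h|h]; [exact h|exfalso].
    assert (hl : locally s (fun u => f u + sg * g u <> 0)).
    { apply (ex_derive_neq0_locally (fun u => f u + sg * g u)); [|lra].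
      exists (f1 + sg * g1 s).
      apply (@is_derive_plus R_AbsRing R_NormedModule); [exact hf|].
      now apply is_derive_scal. }
    destruct (filter_and _ _ hl hloc) as [d hd'].
    destruct (hd' (s + d / 2)) as [h1 h2].
    - change (Rabs (s + d / 2 - s) < d); pose proof (cond_pos d).
      rewrite Rabs_pos_eq; lra.
    - apply h1; rewrite h2; [ring|pose proof (cond_pos d); lra]. }
  apply filter_imp with (2 := hloc); intros u hu.
  destruct (Req_dec u s) as [->|hne']; auto. }
destruct (Req_dec (f s - g s) 0) as [h1|h1].
2:{ exists (-1); split; [now right|]; apply (key 1); [now left|left; lra]. }
destruct (Req_dec (f1 - g1 s) 0) as [h2|h2].
2:{ exists (-1); split; [now right|]; apply (key 1); [now left|right; lra]. }
exists 1; split; [now left|].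
(* Here f - g vanishes at s together with its derivative. If f + g did too, g and g1 would both be
   zero at s, against [hpos]. *)
replace 1 with (- (-1)) by ring; apply (key (-1)); [now right|].
destruct (Req_dec (g s) 0) as [h3|h3]; [right|left; lra].
intros h4; assert (g1 s = 0) by lra; nra.
Qed.

(** Differentiability of f rules out a switch such as |s| against s at a simple zero of g.
    Positivity of g^2 + g1^2 rules out double zeros, where s |s| against s^2 is a differentiable
    switch. *)
Lemma sign_determination lo hi (f g g1 : R -> R) :
  Rbar_lt lo hi ->
  (forall s, interval lo hi s -> f s ^ 2 = g s ^ 2) ->
  (forall s, interval lo hi s -> ex_derive f s) ->
  (forall s, interval lo hi s -> is_derive g s (g1 s)) ->
  (forall s, interval lo hi s -> 0 < g s ^ 2 + g1 s ^ 2) ->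
  exists sg, is_sign sg /\ forall s, interval lo hi s -> f s = sg * g s.
Proof.
intros hlt hsq hf hg hpos.
(* [h] is the sign itself, written as a locally constant expression. *)
set (h := fun s => (f s * g s + Derive f s * g1 s) / (g s ^ 2 + g1 s ^ 2)).
assert (hh : forall s sg, interval lo hi s -> locally s (fun u => f u = sg * g u) ->
  h s = sg).
{ intros s sg hs hl; unfold h.
  assert (hD : Derive f s = sg * g1 s).
  { rewrite (Derive_ext_loc _ _ _ hl); apply is_derive_unique.
    apply is_derive_scal; auto. }
  rewrite hD, (locally_singleton _ _ hl).
  field; specialize (hpos s hs); lra. }
assert (hc : forall s, interval lo hi s -> is_derive h s 0).
{ intros s hs.
  destruct (sign_determination_locally lo hi f g g1 s) as [sg [_ hl]]; auto.
  apply is_derive_ext_loc with (f := fun _ => sg); [|exact (is_derive_const (sg : R_NormedModule) s)].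
  apply locally_locally in hl.
  apply filter_imp with (2 := filter_and _ _ hl (interval_locally _ _ _ hs)).
  intros u [h1 h2]; symmetry; now apply hh. }
destruct (interval_inhabited lo hi hlt) as [u hu].
destruct (sign_determination_locally lo hi f g g1 u) as [sg [hsg hl]]; auto.
exists sg; split; [exact hsg|]; intros s hs.
destruct (sign_determination_locally lo hi f g g1 s) as [sg' [hsg' hl']]; auto.
rewrite (locally_singleton _ _ hl').
rewrite <- (hh u sg hu hl), <- (hh s sg' hs hl').
now rewrite (constant_on_interval lo hi h hc s u hs hu).
Qed.

(** * The functions sn and sn' *)

(** The derivative of [sn kappa] in closed form; [is_derive_sn] transfers its properties to
    [Derive (sn kappa)], the form that occurs in [int_sn]. *)
Definition cs (kappa rho : R) : R :=
  if Rlt_dec 0 kappa then cos (sqrt kappa * rho) else cosh (sqrt (- kappa) * rho).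

Lemma is_derive_cs (kappa x : R) : kappa <> 0 ->
  is_derive (sn kappa) x (cs kappa x) /\
  is_derive (cs kappa) x (- kappa * sn kappa x) /\
  cs kappa x ^ 2 = 1 - kappa * sn kappa x ^ 2.
Proof.
intros hk; unfold sn, cs; destruct (Rlt_dec 0 kappa) as [h|h].
- pose proof (sqrt_lt_R0 kappa h) as hq; pose proof (pow2_sqrt kappa (Rlt_le _ _ h)) as e.
  assert (e1 : kappa * (sin (sqrt kappa * x) / sqrt kappa) = sqrt kappa * sin (sqrt kappa * x)).
  { rewrite <- e at 1; field; lra. }
  split; [|split].
  + auto_derive; [easy|field; lra].
  + auto_derive; [easy|]. rewrite <- Ropp_mult_distr_l, e1; ring.
  + pose proof (sin2_cos2 (sqrt kappa * x)) as e2; unfold Rsqr in e2.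
    replace (kappa * (sin (sqrt kappa * x) / sqrt kappa) ^ 2)
      with (sin (sqrt kappa * x) ^ 2); [simpl; lra|].
    rewrite <- e at 2; field; lra.
- destruct (Rlt_dec kappa 0) as [h'|h']; [|exfalso; lra].
  assert (h0 : 0 < - kappa) by lra.
  pose proof (sqrt_lt_R0 _ h0) as hq; pose proof (pow2_sqrt _ (Rlt_le _ _ h0)) as e.
  set (a := sqrt (- kappa)) in *.
  replace kappa with (- a ^ 2) by lra.
  split; [|split].
  + auto_derive; [easy|field; lra].
  + auto_derive; [easy|field; lra].
  + replace (1 - - a ^ 2 * (sinh (a * x) / a) ^ 2) with (1 + sinh (a * x) ^ 2)
      by (field; lra).
    unfold cosh, sinh.
    assert (exp (a * x) * exp (- (a * x)) = 1).
    { rewrite <- exp_plus, Rplus_opp_r; apply exp_0. }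
    nra.
Qed.

Lemma Derive_sn kappa x : kappa <> 0 -> Derive (sn kappa) x = cs kappa x.
Proof. intros hk; now apply is_derive_unique, is_derive_cs. Qed.

Lemma is_derive_sn (kappa x : R) : kappa <> 0 ->
  is_derive (sn kappa) x (Derive (sn kappa) x) /\
  is_derive (Derive (sn kappa)) x (- kappa * sn kappa x) /\
  Derive (sn kappa) x ^ 2 = 1 - kappa * sn kappa x ^ 2.
Proof.
intros hk; destruct (is_derive_cs kappa x hk) as [h1 [h2 h3]].
rewrite (Derive_sn kappa x hk); split; [exact h1|split; [|exact h3]].
apply is_derive_ext with (f := cs kappa); [|exact h2].
intros u; symmetry; now apply Derive_sn.
Qed.

Lemma sn_pos kappa rho : kappa <> 0 -> polar_radius kappa rho -> 0 < sn kappa rho.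
Proof.
intros hk [h1 h2]; unfold sn; destruct (Rlt_dec 0 kappa) as [h|h].
- pose proof (sqrt_lt_R0 kappa h) as hq; specialize (h2 h).
  apply Rdiv_lt_0_compat; [|exact hq]; apply sin_gt_0; [nra|].
  apply Rmult_lt_compat_l with (1 := hq) in h2.
  replace (sqrt kappa * (PI / sqrt kappa)) with PI in h2 by (field; lra); exact h2.
- destruct (Rlt_dec kappa 0) as [h'|h']; [|exact h1].
  assert (hq : 0 < sqrt (- kappa)) by (apply sqrt_lt_R0; lra).
  apply Rdiv_lt_0_compat; [|exact hq]; rewrite <- sinh_0; apply sinh_lt; nra.
Qed.

(** * A necessary condition on H and I *)

(** Take x = sn'(r) and y = t' S^2 / W. The first integral turns the expression into kappa^2 (S^2 -
    eps y^2). For eps = -1 this is clearly positive; for eps = 1, W^2 (S^2 - y^2) = S^2 (S^2 +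
    b^2). *)
Lemma first_integral_discriminant_pos kappa eps b H I0 lo hi f :
  kappa <> 0 -> is_sign eps ->
  graph_with_first_integral kappa eps b H I0 lo hi f ->
  exists x, 0 < kappa * (1 - x ^ 2) - eps * (kappa * I0 + 2 * H * x) ^ 2.
Proof.
intros hk he [hlt [hr hfi]].
destruct (interval_inhabited _ _ hlt) as [r hrr].
destruct (hr r hrr) as [hp [_ hW]]; specialize (hfi r hrr).
exists (Derive (sn kappa) r).
pose proof (sn_pos _ _ hk hp) as hS.
destruct (is_derive_sn kappa r hk) as [_ [_ hC]].
revert hfi hW; unfold int_sn.
set (w2 := W2 _ _ _ _ _ _).
assert (ew2 : w2 = sn kappa r ^ 2 * (1 + eps * Derive f r ^ 2) + eps * b ^ 2).
{ unfold w2, W2; rewrite Derive_id; ring. }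
revert ew2 hS hC; generalize (sn kappa r) (Derive (sn kappa) r) (Derive f r) w2.
clear -hk he; intros S C t1 w2 ew2 hS hC hfi hW.
pose proof (sqrt_lt_R0 _ hW) as hq; pose proof (pow2_sqrt _ (Rlt_le _ _ hW)) as e.
set (W := sqrt w2) in *.
assert (hy : (kappa * I0 + 2 * H * C) = kappa * (t1 * S ^ 2 / W)).
{ rewrite hfi; field; exact hk. }
rewrite hy, hC.
assert (hpos : 0 < S ^ 2 - eps * (t1 * S ^ 2 / W) ^ 2).
{ destruct he as [-> | ->].
  - apply Rmult_lt_reg_l with w2; [exact hW|rewrite Rmult_0_r].
    replace (w2 * (S ^ 2 - 1 * (t1 * S ^ 2 / W) ^ 2)) with (S ^ 2 * (S ^ 2 + b ^ 2)).
    + apply Rmult_lt_0_compat; nra.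
    + rewrite <- e.
      replace (W ^ 2 * (S ^ 2 - 1 * (t1 * S ^ 2 / W) ^ 2))
        with (W ^ 2 * S ^ 2 - t1 ^ 2 * S ^ 4) by (field; lra).
      rewrite e, ew2; ring.
  - pose proof (pow2_ge_0 (t1 * S ^ 2 / W)); nra. }
replace (kappa * (1 - (1 - kappa * S ^ 2)) - eps * (kappa * (t1 * S ^ 2 / W)) ^ 2)
  with (kappa ^ 2 * (S ^ 2 - eps * (t1 * S ^ 2 / W) ^ 2)) by ring.
apply Rmult_lt_0_compat; [|exact hpos]; assert (0 < kappa * kappa) by nra; nra.
Qed.

(** * Fundamental forms and mean curvature of a screw surface *)

Lemma partial_metric_eq kappa eps k i j p : kappa <> 0 ->
  partial_metric kappa eps k i j p =
  match k, i, j with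
  | Rho, Theta, Theta => 2 * sn kappa (p Rho) * Derive (sn kappa) (p Rho)
  | _, _, _ => 0
  end.
Proof.
intros hk; unfold partial_metric, metric, upd.
destruct k, i, j; simpl; try apply Derive_const.
apply is_derive_unique.
pose proof (is_derive_pow _ 2 _ _ (proj1 (is_derive_sn kappa (p Rho) hk))) as h.
replace (2 * sn kappa (p Rho) * Derive (sn kappa) (p Rho))
  with (INR 2 * Derive (sn kappa) (p Rho) * sn kappa (p Rho) ^ Nat.pred 2)
  by (simpl; ring).
exact h.
Qed.

(** Only g_theta,theta varies, and only with rho, so the surviving Christoffel symbols are S S'
    (indices rho, theta; theta) and - S S' (indices theta, theta; rho). *)
Lemma second_form_eq kappa eps p Xab Xa Xb N : kappa <> 0 ->
  second_form kappa eps p Xab Xa Xb N =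
  N Rho * (Xab Rho - sn kappa (p Rho) * Derive (sn kappa) (p Rho) * Xa Theta * Xb Theta)
  + N Theta * (sn kappa (p Rho) ^ 2 * Xab Theta
      + sn kappa (p Rho) * Derive (sn kappa) (p Rho)
        * (Xa Rho * Xb Theta + Xa Theta * Xb Rho))
  + N Height * (eps * Xab Height).
Proof.
intros hk; unfold second_form, christoffel, csum.
rewrite !partial_metric_eq by exact hk.
unfold metric; field.
Qed.

Lemma inner_eq kappa eps p u v :
  inner kappa eps p u v =
  u Rho * v Rho + sn kappa (p Rho) ^ 2 * u Theta * v Theta + eps * u Height * v Height.
Proof. unfold inner, csum, metric; ring. Qed.

Lemma profile_surface_d1 m b eta (rho t Th : R -> R) s v r1 t1 h1 :
  is_derive rho s r1 -> is_derive t s t1 -> is_derive Th s h1 ->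
  forall i, is_derive (fun u => profile_surface m b eta rho t Th u v i) s
    (mkvec r1 (eta * h1) (t1 + b * (eta * h1)) i).
Proof.
intros hr ht hh.
assert (he : is_derive (fun u => v / m + eta * Th u) s (eta * h1)).
{ auto_derive; [now exists h1|].
  replace (Derive (fun u : R => Th u) s) with h1 by (symmetry; now apply is_derive_unique).
  ring. }
intros [| |]; simpl; [exact hr|exact he|].
apply (@is_derive_plus R_AbsRing R_NormedModule); [exact ht|].
now apply is_derive_scal.
Qed.

Lemma profile_surface_d2 m b eta rho t Th s v i :
  is_derive (fun u => profile_surface m b eta rho t Th s u i) v
    (mkvec 0 (/ m) (b * / m) i).
Proof.
destruct i; simpl; auto_derive; try easy; unfold Rdiv; ring.
Qed.

(** Velocities are functions on [coord] known only componentwise; this congruence and the next one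
    stand in for functional extensionality. *)
Lemma inner_ext kappa eps p u v u' v' :
  (forall i, u i = u' i) -> (forall i, v i = v' i) ->
  inner kappa eps p u v = inner kappa eps p u' v'.
Proof. intros hu hv; rewrite !inner_eq, !hu, !hv; reflexivity. Qed.

Lemma second_form_ext kappa eps p w u v w' u' v' N : kappa <> 0 ->
  (forall i, w i = w' i) -> (forall i, u i = u' i) -> (forall i, v i = v' i) ->
  second_form kappa eps p w u v N = second_form kappa eps p w' u' v' N.
Proof. intros hk hw hu hv; rewrite !second_form_eq, !hu, !hv, !hw by exact hk; reflexivity. Qed.

(* The left-hand side of the last hypothesis, times [- S r1], is [W ^ 3] times the derivative
   of [t1 S ^ 2 / W]; undivided, it also covers the points where [r1 = 0]. *)
Lemma profile_surface_cmc kappa eps m b eta H lo hi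
  (rho t Th r1 t1 h1 r2 t2 h2 : R -> R) :
  kappa <> 0 -> is_sign eps -> m <> 0 ->
  (forall s, interval lo hi s ->
    polar_radius kappa (rho s) /\
    is_derive rho s (r1 s) /\ is_derive t s (t1 s) /\ is_derive Th s (h1 s) /\
    is_derive r1 s (r2 s) /\ is_derive t1 s (t2 s) /\ is_derive h1 s (h2 s)) ->
  (forall s, interval lo hi s ->
    0 < W2 kappa eps b rho t s /\ 0 < sn kappa (rho s) ^ 2 + eps * b ^ 2) ->
  (forall s, interval lo hi s ->
    let S := sn kappa (rho s) in let C := Derive (sn kappa) (rho s) in
    (S * t1 s * r2 s - S * r1 s * t2 s) * (S ^ 2 + eps * b ^ 2)
    - 2 * eps * b ^ 2 * C * r1 s ^ 2 * t1 s
    - S ^ 2 * C * t1 s * (r1 s ^ 2 + eps * t1 s ^ 2)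
    = 2 * H * sqrt (W2 kappa eps b rho t s) ^ 3) ->
  constant_mean_curvature kappa eps (interval lo hi)
    (profile_surface m b eta rho t Th)
    (fun s _ => helicoidal_normal kappa eps b rho t s) H.
Proof.
intros hk he hm hd hpos hH.
set (X := profile_surface m b eta rho t Th).
set (a1 := fun s i => mkvec (r1 s) (eta * h1 s) (t1 s + b * (eta * h1 s)) i).
set (a2 := fun i => mkvec 0 (/ m) (b * / m) i).
set (a11 := fun s i => mkvec (r2 s) (eta * h2 s) (t2 s + b * (eta * h2 s)) i).
assert (D1 : forall (s v : R) i, interval lo hi s -> is_derive (fun u : R => X u v i) s (a1 s i)).
{ intros s v i hs; destruct (hd s hs) as [_ [h [h' [h'' _]]]].
  now apply profile_surface_d1. }
assert (E1 : forall (s v : R) i, interval lo hi s -> Defs.d1 X s v i = a1 s i).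
{ intros s v i hs; now apply is_derive_unique, D1. }
assert (D2 : forall (s v : R) i, is_derive (fun u : R => X s u i) v (a2 i))
  by (intros; apply profile_surface_d2).
assert (E2 : forall (s v : R) i, Defs.d2 X s v i = a2 i)
  by (intros; now apply is_derive_unique, D2).
assert (D11 : forall (s v : R) i, interval lo hi s ->
  is_derive (fun u : R => Defs.d1 X u v i) s (a11 s i)).
{ intros s v i hs; apply is_derive_ext_loc with (f := fun u => a1 u i).
  - apply (locally_on lo hi) with (2 := hs); intros u hu; symmetry; now apply E1.
  - destruct (hd s hs) as [_ [_ [_ [_ [h [h' h'']]]]]].
    (* The velocity [a1] has the shape of the surface itself, with (rho, t, Th) replaced by (r1, t1,
       h1) and v = 0, so the same derivative formula applies. *)
    generalize (profile_surface_d1 m b eta r1 t1 h1 s 0 _ _ _ h h' h'' i).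
    apply is_derive_ext; intros u; unfold a1.
    destruct i; simpl; unfold Rdiv; ring. }
assert (E11 : forall (s v : R) i, interval lo hi s -> Defs.d1 (Defs.d1 X) s v i = a11 s i).
{ intros s v i hs; now apply is_derive_unique, D11. }
assert (D12 : forall (s v : R) i, is_derive (fun u : R => Defs.d2 X u v i) s (mkvec 0 0 0 i)).
{ intros s v i; apply is_derive_ext with (f := fun _ => a2 i).
  - intros u; symmetry; apply E2.
  - destruct i; apply (@is_derive_const R_AbsRing R_NormedModule). }
assert (E12 : forall (s v : R) i, Defs.d1 (Defs.d2 X) s v i = mkvec 0 0 0 i)
  by (intros; apply is_derive_unique, D12).
assert (D22 : forall (s v : R) i, is_derive (fun u : R => Defs.d2 X s u i) v (mkvec 0 0 0 i)).
{ intros s v i; apply is_derive_ext with (f := fun _ => a2 i).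
  - intros u; symmetry; apply E2.
  - destruct i; apply (@is_derive_const R_AbsRing R_NormedModule). }
assert (E22 : forall (s v : R) i, Defs.d2 (Defs.d2 X) s v i = mkvec 0 0 0 i)
  by (intros; apply is_derive_unique, D22).
assert (D21 : forall (s v : R) i, interval lo hi s -> ex_derive (fun u : R => Defs.d1 X s u i) v).
{ intros s v i hs; apply ex_derive_ext with (f := fun _ => a1 s i).
  - intros u; symmetry; now apply E1.
  - apply (@ex_derive_const R_AbsRing R_NormedModule). }
assert (eE : forall s v, interval lo hi s ->
  ffE kappa eps X s v = inner kappa eps (X s v) (a1 s) (a1 s)).
{ intros s v hs; apply inner_ext; intros i; now apply E1. }
assert (eF : forall s v, interval lo hi s ->
  ffF kappa eps X s v = inner kappa eps (X s v) (a1 s) a2).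
{ intros s v hs; apply inner_ext; intros i; [now apply E1|apply E2]. }
assert (eG : forall s v, ffG kappa eps X s v = inner kappa eps (X s v) a2 a2).
{ intros s v; apply inner_ext; intros i; apply E2. }
assert (eX : forall s v, X s v Rho = rho s) by reflexivity.
assert (eW : forall s, interval lo hi s -> W2 kappa eps b rho t s =
  sn kappa (rho s) ^ 2 * (r1 s ^ 2 + eps * t1 s ^ 2) + eps * b ^ 2 * r1 s ^ 2).
{ intros s hs; unfold W2; destruct (hd s hs) as [_ [h [h' _]]].
  now rewrite (is_derive_unique _ _ _ h), (is_derive_unique _ _ _ h'). }
(* The drift of theta adds m eta h1 times [a2] to the velocity (r1, 0, t1), so it disappears from
   the Gram determinant. *)
assert (eEG : forall s v, interval lo hi s ->
  ffE kappa eps X s v * ffG kappa eps X s v - ffF kappa eps X s v ^ 2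
  = W2 kappa eps b rho t s / m ^ 2).
{ intros s v hs; rewrite eE, eF, eG, !inner_eq, eX, eW by exact hs; simpl.
  destruct he as [-> | ->]; field; exact hm. }
assert (hm2 : 0 < m ^ 2) by (rewrite <- Rsqr_pow2; now apply Rlt_0_sqr).
split.
- intros s v hs; rewrite eX; now apply hd.
- split; [|split]; intros s v i hs; split.
  + exists (a1 s i); now apply D1.
  + exists (a2 i); now apply D2.
  + exists (a11 s i); now apply D11.
  + now apply D21.
  + eexists; now apply D12.
  + eexists; now apply D22.
- intros s v hs; rewrite eEG by exact hs; destruct (hpos s hs) as [h1' h2'].
  assert (hq : 0 < W2 kappa eps b rho t s / m ^ 2) by now apply Rdiv_lt_0_compat.
  split; [|exact hq].
  (* E > 0 follows from G > 0 and E G > F^2; for eps = -1 the formula for E alone does not show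
     it. *)
  assert (hG : 0 < ffG kappa eps X s v).
  { rewrite eG, inner_eq, eX; simpl.
    replace (0 * 0 + _ + _) with ((sn kappa (rho s) ^ 2 + eps * b ^ 2) / m ^ 2)
      by (field; exact hm).
    now apply Rdiv_lt_0_compat. }
  rewrite <- (eEG s v hs) in hq.
  pose proof (pow2_ge_0 (ffF kappa eps X s v)); nra.
- intros s v hs; destruct (hpos s hs) as [h1' _]; destruct (hd s hs) as [hp [h [h' _]]].
  rewrite (inner_ext _ _ (X s v) _ (Defs.d1 X s v) _ (a1 s) (fun i => eq_refl) (fun i => E1 s v i hs)).
  rewrite (inner_ext _ _ (X s v) _ (Defs.d2 X s v) _ a2 (fun i => eq_refl) (fun i => E2 s v i)).
  rewrite !inner_eq, eX; unfold helicoidal_normal; simpl.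
  rewrite (is_derive_unique _ _ _ h), (is_derive_unique _ _ _ h').
  pose proof (sn_pos _ _ hk hp) as hS.
  pose proof (sqrt_lt_R0 _ h1') as hW; pose proof (pow2_sqrt _ (Rlt_le _ _ h1')) as e.
  rewrite eW in e at 2 by exact hs.
  revert e hW hS; generalize (sn kappa (rho s)) (sqrt (W2 kappa eps b rho t s)).
  intros S W e hW hS; split; [|split].
  + apply Rmult_eq_reg_r with (W ^ 2); [|apply pow_nonzero; lra].
    rewrite e at 2; destruct he as [-> | ->]; field; lra.
  + destruct he as [-> | ->]; field; lra.
  + destruct he as [-> | ->]; field; lra.
- intros s v hs; destruct (hpos s hs) as [h1' _]; destruct (hd s hs) as [hp [h [h' _]]].
  specialize (hH s hs); cbv zeta in hH.
  pose proof (sqrt_lt_R0 _ h1') as hW; pose proof (pow2_sqrt _ (Rlt_le _ _ h1')) as e.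
  assert (e' : W2 kappa eps b rho t s / m ^ 2 = sqrt (W2 kappa eps b rho t s) ^ 2 / m ^ 2)
    by now rewrite e.
  unfold mean_curvature; rewrite (eEG s v hs), e'; unfold sfe, sff, sfg.
  rewrite (second_form_ext _ _ _ _ _ _ (a11 s) (a1 s) (a1 s) _ hk)
    by (intros i; try apply E11; try apply E1; exact hs).
  rewrite (second_form_ext _ _ _ (Defs.d1 (Defs.d2 X) s v) _ _ (mkvec 0 0 0) (a1 s) a2 _ hk)
    by (intros i; try apply E12; try apply E1; try apply E2; exact hs).
  rewrite (second_form_ext _ _ _ (Defs.d2 (Defs.d2 X) s v) _ _ (mkvec 0 0 0) a2 a2 _ hk)
    by (intros i; try apply E22; apply E2).
  rewrite !second_form_eq by exact hk.
  rewrite eE, eF, eG, !inner_eq, eX by exact hs; unfold helicoidal_normal; simpl.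
  rewrite (is_derive_unique _ _ _ h), (is_derive_unique _ _ _ h').
  pose proof (sn_pos _ _ hk hp) as hS.
  clear e e'; revert hH hW hS; generalize (sn kappa (rho s)) (Derive (sn kappa) (rho s))
    (sqrt (W2 kappa eps b rho t s)).
  clear - he hm; intros S C W hH hW hS.
  (* All terms in m, eta, h1 and h2 cancel, leaving the curvature of the profile with theta itself
     as parameter. *)
  transitivity (((S * t1 s * r2 s - S * r1 s * t2 s) * (S ^ 2 + eps * b ^ 2)
    - 2 * eps * b ^ 2 * C * r1 s ^ 2 * t1 s
    - S ^ 2 * C * t1 s * (r1 s ^ 2 + eps * t1 s ^ 2)) / (2 * W ^ 3)).
  + destruct he as [-> | ->]; field; lra.
  + rewrite hH; field; lra.
Qed.

(** * The differential equation for z and its solutions *)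

(** The second-order equation is the derivative of the first-order one divided by 2 z1. It gives z1'
    where z1 = 0 and excludes the constant solutions at simple roots of the quadratic. *)
Definition cmc_ode (kappa eps H I0 : R) (z z1 : R -> R) : Prop :=
  forall s, is_derive z s (z1 s) /\
    is_derive z1 s (- kappa * z s - 2 * eps * H * (kappa * I0 + 2 * H * z s)) /\
    z1 s ^ 2 = kappa * (1 - z s ^ 2) - eps * (kappa * I0 + 2 * H * z s) ^ 2.

(** The right-hand side is - A z^2 - 4 eps kappa H I z + kappa (1 - kappa I^2 eps). For A nonzero, u
    = z + 2 H kappa I eps / A removes the linear term; for A = 0 the expression is constant (iv) or
    linear (v). *)
Lemma cmc_ode_of_explicit_form kappa eps H I0 s0 A c (z : R -> R) :
  is_sign eps -> A = 4 * H ^ 2 * eps + kappa ->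
  (A <> 0 -> c ^ 2 = Rabs (kappa / A ^ 2 * (A - kappa ^ 2 * I0 ^ 2 * eps))) ->
  (A < 0 /\ kappa * (A - kappa ^ 2 * I0 ^ 2 * eps) < 0 /\
      forall s, z s = c * sinh (sqrt (- A) * (s - s0)) - 2 * H * kappa * I0 * eps / A)
   \/
   (A < 0 /\ 0 < kappa * (A - kappa ^ 2 * I0 ^ 2 * eps) /\
      forall s, z s = c * cosh (sqrt (- A) * (s - s0)) - 2 * H * kappa * I0 * eps / A)
   \/
   (0 < A /\ 0 < kappa * (A - kappa ^ 2 * I0 ^ 2 * eps) /\
      forall s, z s = c * sin (sqrt A * (s - s0)) - 2 * H * kappa * I0 * eps / A)
   \/
   (A = 0 /\ H * kappa * I0 = 0 /\ 0 < kappa * (1 - kappa * I0 ^ 2 * eps) /\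
      forall s, z s = sqrt (kappa * (1 - kappa * I0 ^ 2 * eps)) * (s - s0))
   \/
   (A = 0 /\ H * kappa * I0 <> 0 /\
      forall s, z s = - (1 / (4 * H * kappa * I0 * eps)) *
        ((4 * H * kappa * I0 * eps) ^ 2 * (1 / 4 * (s - s0) ^ 2)
         - kappa * (1 - kappa * I0 ^ 2 * eps))) ->
  exists z1, cmc_ode kappa eps H I0 z z1.
Proof.
intros he hA hc hz.
assert (he0 : eps <> 0) by (destruct he; lra).
assert (build : forall y y1 : R -> R,
  (forall s, z s = y s) -> (forall s, is_derive y s (y1 s)) ->
  (forall s, is_derive y1 s (- A * y s - 2 * eps * kappa * H * I0)) ->
  (forall s, y1 s ^ 2 = - A * y s ^ 2 - 4 * eps * kappa * H * I0 * y s
     + kappa * (1 - kappa * I0 ^ 2 * eps)) ->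
  exists z1, cmc_ode kappa eps H I0 z z1).
{ intros y y1 hy h1 h2 h3; exists y1; intros s; split; [|split].
  - apply is_derive_ext with (f := y); [now intros u|apply h1].
  - rewrite hy; replace (- kappa * y s - 2 * eps * H * (kappa * I0 + 2 * H * y s))
      with (- A * y s - 2 * eps * kappa * H * I0) by (rewrite hA; ring); apply h2.
  - rewrite hy, h3, hA; ring. }
(* The right-hand side of the equation for [y1 ^ 2], with the square completed. *)
assert (square : forall y u, A <> 0 -> y = u - 2 * H * kappa * I0 * eps / A ->
  - A * y ^ 2 - 4 * eps * kappa * H * I0 * y + kappa * (1 - kappa * I0 ^ 2 * eps)
  = - A * u ^ 2 + kappa / A * (A - kappa ^ 2 * I0 ^ 2 * eps)).
{ intros y u hA0 ->.
  replace (kappa / A * (A - kappa ^ 2 * I0 ^ 2 * eps))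
    with (kappa * (1 - kappa * I0 ^ 2 * eps)
      + kappa ^ 2 * I0 ^ 2 * eps * (A - kappa) / A) by (field; exact hA0).
  replace (A - kappa) with (4 * H ^ 2 * eps) by lra; field; exact hA0. }
(* The sign e resolves the absolute value in c^2, giving u'^2 = A (e c^2 - u^2): sinh for A < 0, e =
   -1; cosh for A < 0, e = 1; sin for A > 0, e = 1. *)
assert (hcA : A <> 0 -> forall e, is_sign e ->
  0 < e * (kappa * (A - kappa ^ 2 * I0 ^ 2 * eps)) ->
  kappa / A * (A - kappa ^ 2 * I0 ^ 2 * eps) = e * A * c ^ 2).
{ intros hA0 e hse hpos.
  assert (hA2 : 0 < A ^ 2) by (rewrite <- Rsqr_pow2; now apply Rlt_0_sqr).
  rewrite (hc hA0).
  assert (hR : Rabs (kappa / A ^ 2 * (A - kappa ^ 2 * I0 ^ 2 * eps))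
    = e * (kappa / A ^ 2 * (A - kappa ^ 2 * I0 ^ 2 * eps))).
  { assert (hp : 0 < e * (kappa / A ^ 2 * (A - kappa ^ 2 * I0 ^ 2 * eps))).
    { replace (e * (kappa / A ^ 2 * (A - kappa ^ 2 * I0 ^ 2 * eps)))
        with (e * (kappa * (A - kappa ^ 2 * I0 ^ 2 * eps)) / A ^ 2) by (field; exact hA0).
      now apply Rdiv_lt_0_compat. }
    destruct hse as [-> | ->].
    - rewrite Rabs_pos_eq; lra.
    - rewrite Rabs_left; lra. }
  rewrite hR; destruct hse as [-> | ->]; field; exact hA0. }
assert (hyp : forall x, cosh x ^ 2 = 1 + sinh x ^ 2).
{ intros x; unfold cosh, sinh.
  assert (exp x * exp (- x) = 1) by (rewrite <- exp_plus, Rplus_opp_r; apply exp_0).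
  nra. }
destruct hz as [[hA0 [hd hz]]|[[hA0 [hd hz]]|[[hA0 [hd hz]]|[[hA0 [hd [hd' hz]]]|[hA0 [hd hz]]]]]].
- assert (h0 : 0 < - A) by lra; pose proof (pow2_sqrt _ (Rlt_le _ _ h0)) as e.
  set (a := sqrt (- A)) in *.
  apply build with (1 := hz) (y1 := fun s => c * a * cosh (a * (s - s0))).
  + intros s; auto_derive; [easy|fold a]; change (s + - s0) with (s - s0); ring.
  + intros s; auto_derive; [easy|fold a]; change (s + - s0) with (s - s0); rewrite <- e.
    replace (2 * H * kappa * I0 * eps / A) with (- (2 * H * kappa * I0 * eps / a ^ 2))
      by (rewrite e; field; lra).
    field; intros h; rewrite h in e; simpl in e; lra.
  + intros s; rewrite (square _ (c * sinh (a * (s - s0)))) by (reflexivity || lra).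
    rewrite (hcA ltac:(lra) (-1)) by (now right || lra).
    rewrite !Rpow_mult_distr, e, hyp; ring.
- assert (h0 : 0 < - A) by lra; pose proof (pow2_sqrt _ (Rlt_le _ _ h0)) as e.
  set (a := sqrt (- A)) in *.
  apply build with (1 := hz) (y1 := fun s => c * a * sinh (a * (s - s0))).
  + intros s; auto_derive; [easy|fold a]; change (s + - s0) with (s - s0); ring.
  + intros s; auto_derive; [easy|fold a]; change (s + - s0) with (s - s0); rewrite <- e.
    replace (2 * H * kappa * I0 * eps / A) with (- (2 * H * kappa * I0 * eps / a ^ 2))
      by (rewrite e; field; lra).
    field; intros h; rewrite h in e; simpl in e; lra.
  + intros s; rewrite (square _ (c * cosh (a * (s - s0)))) by (reflexivity || lra).
    rewrite (hcA ltac:(lra) 1) by (now left || lra).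
    rewrite !Rpow_mult_distr, e, hyp; ring.
- pose proof (pow2_sqrt _ (Rlt_le _ _ hA0)) as e.
  set (a := sqrt A) in *.
  apply build with (1 := hz) (y1 := fun s => c * a * cos (a * (s - s0))).
  + intros s; auto_derive; [easy|fold a]; change (s + - s0) with (s - s0); ring.
  + intros s; auto_derive; [easy|fold a]; change (s + - s0) with (s - s0); rewrite <- e.
    field; intros h; rewrite h in e; simpl in e; lra.
  + intros s; rewrite (square _ (c * sin (a * (s - s0)))) by (reflexivity || lra).
    rewrite (hcA ltac:(lra) 1) by (now left || lra).
    pose proof (sin2_cos2 (a * (s - s0))) as e2; rewrite !Rsqr_pow2 in e2.
    rewrite !Rpow_mult_distr, e.
    replace (cos (a * (s - s0)) ^ 2) with (1 - sin (a * (s - s0)) ^ 2) by lra; ring.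
- pose proof (pow2_sqrt _ (Rlt_le _ _ hd')) as e.
  set (a := sqrt (kappa * (1 - kappa * I0 ^ 2 * eps))) in *.
  apply build with (1 := hz) (y1 := fun s => a).
  + intros s; auto_derive; [easy|]; ring.
  + intros s; replace (- A * _ - 2 * eps * kappa * H * I0) with 0
      by (rewrite hA0; replace (2 * eps * kappa * H * I0) with (2 * eps * (H * kappa * I0))
            by ring; rewrite hd; ring).
    apply (@is_derive_const R_AbsRing R_NormedModule).
  + intros s; rewrite e, hA0.
    replace (4 * eps * kappa * H * I0) with (4 * eps * (H * kappa * I0)) by ring.
    rewrite hd; ring.
- assert (hB : 4 * H * kappa * I0 * eps <> 0).
  { replace (4 * H * kappa * I0 * eps) with (4 * (H * kappa * I0) * eps) by ring.
    apply Rmult_integral_contrapositive_currified; [|exact he0].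
    apply Rmult_integral_contrapositive_currified; [lra|exact hd]. }
  set (B := 4 * H * kappa * I0 * eps) in *.
  assert (hB1 : 2 * eps * kappa * H * I0 = B / 2) by (unfold B; field).
  assert (hB2 : 4 * eps * kappa * H * I0 = B) by (unfold B; ring).
  (* The equation is now z'^2 = K - B z with K = kappa (1 - kappa I^2 eps). The factor [B ^ 2] on (s
     - s0)^2 / 4 is essential: without it, as in the English form of (v), the equation holds only
     for B^2 = 1. *)
  apply build with (1 := hz) (y1 := fun s => - (B / 2) * (s - s0)); intros s;
    rewrite ?hB1, ?hB2, ?hA0.
  + auto_derive; [easy|]; field; exact hB.
  + auto_derive; [easy|]; field; exact hB.
  + field; exact hB.
Qed.

(** * Antiderivatives and the inverse of sn' *)

Lemma antiderivative_on_interval lo hi (f : R -> R) :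
  Rbar_lt lo hi -> (forall s, interval lo hi s -> continuous f s) ->
  exists F, forall s, interval lo hi s -> is_derive F s (f s).
Proof.
intros hlt hf; destruct (interval_inhabited lo hi hlt) as [a ha].
exists (RInt f a); intros s hs.
apply (is_derive_RInt f (RInt f a) a s); [|now apply hf].
apply (locally_on lo hi) with (2 := hs); intros u hu.
apply (RInt_correct (V := R_CompleteNormedModule) f a u), (ex_RInt_continuous (V := R_CompleteNormedModule)).
intros x hx; apply hf.
destruct (Rle_dec a u) as [h|h].
- rewrite Rmin_left, Rmax_right in hx by lra.
  exact (interval_between _ _ _ _ _ ha hu hx).
- rewrite Rmin_right, Rmax_left in hx by lra.
  exact (interval_between _ _ _ _ _ hu ha hx).
Qed.

(** Inverse of sn' on the polar chart; for kappa < 0 the inverse of cosh at x > 1 is written as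
    arcsinh of sqrt(x^2 - 1). *)
Definition radius_of_cs (kappa x : R) : R :=
  if Rlt_dec 0 kappa then acos x / sqrt kappa
  else arcsinh (sqrt (x ^ 2 - 1)) / sqrt (- kappa).

Lemma radius_of_cs_spec kappa x :
  kappa <> 0 -> 0 < x -> 0 < (1 - x ^ 2) / kappa ->
  polar_radius kappa (radius_of_cs kappa x) /\
  sn kappa (radius_of_cs kappa x) ^ 2 = (1 - x ^ 2) / kappa /\
  Derive (sn kappa) (radius_of_cs kappa x) = x /\
  ex_derive (radius_of_cs kappa) x.
Proof.
intros hk hx hq.
assert (hsq : Derive (sn kappa) (radius_of_cs kappa x) = x ->
  sn kappa (radius_of_cs kappa x) ^ 2 = (1 - x ^ 2) / kappa).
{ intros h; destruct (is_derive_sn kappa (radius_of_cs kappa x) hk) as [_ [_ e]].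
  rewrite h in e; rewrite e; field; exact hk. }
rewrite (Derive_sn _ _ hk) in *.
enough (h : polar_radius kappa (radius_of_cs kappa x) /\
  cs kappa (radius_of_cs kappa x) = x /\ ex_derive (radius_of_cs kappa) x).
{ destruct h as [h1 [h2 h3]]; split; [exact h1|]; split; [now apply hsq|now split]. }
assert (hk' : kappa * ((1 - x ^ 2) / kappa) = 1 - x ^ 2) by (field; exact hk).
unfold cs, polar_radius, radius_of_cs; destruct (Rlt_dec 0 kappa) as [h|h].
- assert (hx1 : -1 < x < 1) by nra.
  pose proof (sqrt_lt_R0 _ h) as hs; pose proof (acos_bound_lt x hx1) as ha.
  split; [|split].
  + split; [now apply Rdiv_lt_0_compat|]; intros _.
    apply Rmult_lt_compat_r; [now apply Rinv_0_lt_compat|easy].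
  + replace (sqrt kappa * (acos x / sqrt kappa)) with (acos x) by (field; lra).
    apply cos_acos; lra.
  + unfold Rdiv; apply ex_derive_mult; [|apply (@ex_derive_const R_AbsRing R_NormedModule)].
    apply ex_derive_Reals_1; now apply derivable_pt_acos.
- assert (hx1 : 0 < x ^ 2 - 1) by nra.
  assert (hs : 0 < sqrt (- kappa)) by (apply sqrt_lt_R0; lra).
  pose proof (sqrt_lt_R0 _ hx1) as hr.
  split; [|split].
  + split; [|lra]; apply Rdiv_lt_0_compat; [|exact hs].
    rewrite <- arcsinh_0; now apply arcsinh_lt.
  + replace (sqrt (- kappa) * (arcsinh (sqrt (x ^ 2 - 1)) / sqrt (- kappa)))
      with (arcsinh (sqrt (x ^ 2 - 1))) by (field; lra).
    set (y := arcsinh _).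
    assert (hy : sinh y ^ 2 = x ^ 2 - 1).
    { unfold y; rewrite sinh_arcsinh; apply pow2_sqrt; lra. }
    assert (hc : 0 < cosh y).
    { unfold cosh; pose proof (exp_pos y); pose proof (exp_pos (- y)); lra. }
    assert (hyp : cosh y ^ 2 = 1 + sinh y ^ 2).
    { unfold cosh, sinh.
      assert (exp y * exp (- y) = 1) by (rewrite <- exp_plus, Rplus_opp_r; apply exp_0).
      nra. }
    nra.
  + unfold Rdiv; apply ex_derive_mult; [|apply (@ex_derive_const R_AbsRing R_NormedModule)].
    apply (ex_derive_comp arcsinh (fun u => sqrt (u ^ 2 - 1))).
    * eexists; apply is_derive_Reals, derivable_pt_lim_arcsinh.
    * auto_derive; exact hx1.
Qed.

(** * Derivatives of U and rho, and the two radicands, in terms of z *)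

Lemma determined_by_sqr kappa eps m b z lo hi U s :
  kappa <> 0 -> determined_by kappa eps m b z (interval lo hi) U -> interval lo hi s ->
  0 < z s /\ radius2 eps m b U s = (1 - z s ^ 2) / kappa.
Proof.
intros hk hU hs; destruct (hU s hs) as [_ [_ [h ->]]]; split.
- now apply sqrt_lt_R0.
- rewrite pow2_sqrt by lra; field; exact hk.
Qed.

(** No regularity of U is assumed: near s it equals the square root of a differentiable, positive
    function of z. *)
Lemma determined_by_derive kappa eps m b z lo hi U s z1 :
  kappa <> 0 -> m <> 0 -> determined_by kappa eps m b z (interval lo hi) U ->
  interval lo hi s -> is_derive z s z1 ->
  is_derive U s (- (z s * z1) / (kappa * m ^ 2 * U s)).
Proof.
intros hk hm hU hs hz.
assert (hm2 : 0 < m ^ 2) by (rewrite <- Rsqr_pow2; now apply Rlt_0_sqr).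
assert (hsq : forall u, interval lo hi u ->
  U u ^ 2 = ((1 - z u ^ 2) / kappa + eps * b ^ 2) / m ^ 2).
{ intros u hu; destruct (determined_by_sqr _ _ _ _ _ _ _ _ u hk hU hu) as [_ <-].
  unfold radius2; field; exact hm. }
assert (hform : forall u, interval lo hi u ->
  sqrt (((1 - z u ^ 2) / kappa + eps * b ^ 2) / m ^ 2) = U u).
{ intros u hu; rewrite <- hsq by exact hu; apply sqrt_pow2.
  destruct (hU u hu) as [h _]; lra. }
apply is_derive_ext_loc with
  (f := fun u => sqrt (((1 - z u ^ 2) / kappa + eps * b ^ 2) / m ^ 2)).
- now apply (locally_on lo hi).
- destruct (hU s hs) as [hUs _].
  assert (hinner : is_derive (fun u => ((1 - z u ^ 2) / kappa + eps * b ^ 2) / m ^ 2) s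
    (- (2 * z s * z1) / (kappa * m ^ 2))).
  { auto_derive; [now exists z1|].
    replace (Derive (fun u : R => z u) s) with z1 by (symmetry; now apply is_derive_unique).
    field; now split. }
  generalize (is_derive_sqrt _ s _ hinner); rewrite hform, <- hsq by exact hs.
  intros h; replace (- (z s * z1) / (kappa * m ^ 2 * U s))
    with (- (2 * z s * z1) / (kappa * m ^ 2) / (2 * U s)).
  + apply h; rewrite <- Rsqr_pow2; apply Rlt_0_sqr; lra.
  + field; repeat split; lra || assumption.
Qed.

(** Since m^2 U U' = - z z1 / kappa and 1 - kappa q = z^2 for the squared radius q, the factor z^2
    cancels. This leaves R0^2 = eps (q - z1^2 / kappa^2), a square by the first-order equation. *)
Lemma determined_by_radicands kappa eps m b H I0 z z1 lo hi U s :
  kappa <> 0 -> is_sign eps -> m <> 0 -> cmc_ode kappa eps H I0 z z1 ->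
  determined_by kappa eps m b z (interval lo hi) U -> interval lo hi s ->
  drho_radicand kappa eps m b U s = z1 s ^ 2 / (kappa ^ 2 * radius2 eps m b U s) /\
  R0_radicand kappa eps m b U s = (I0 + 2 * H * z s / kappa) ^ 2.
Proof.
intros hk he hm ho hU hs.
destruct (hU s hs) as [hUs [hq _]].
destruct (determined_by_sqr _ _ _ _ _ _ _ _ s hk hU hs) as [hz hqz].
destruct (ho s) as [hz1 [_ hsq]].
assert (hz2 : 1 - kappa * radius2 eps m b U s = z s ^ 2)
  by (rewrite hqz; field; exact hk).
assert (hU2 : m ^ 4 * U s ^ 2 * Derive U s ^ 2 = z s ^ 2 * z1 s ^ 2 / kappa ^ 2).
{ rewrite (is_derive_unique _ _ _ (determined_by_derive _ _ _ _ _ _ _ _ _ _ hk hm hU hs hz1)).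
  field; repeat split; lra || assumption. }
unfold drho_radicand, R0_radicand; rewrite hU2, hz2; split.
- field; repeat split; lra || assumption.
- replace ((I0 + 2 * H * z s / kappa) ^ 2)
    with ((kappa * I0 + 2 * H * z s) ^ 2 / kappa ^ 2) by (field; exact hk).
  assert (h : eps * (kappa * I0 + 2 * H * z s) ^ 2 = kappa * (1 - z s ^ 2) - z1 s ^ 2)
    by lra.
  replace ((kappa * I0 + 2 * H * z s) ^ 2)
    with (eps * (kappa * (1 - z s ^ 2) - z1 s ^ 2)).
  + rewrite hqz; field; repeat split; lra || assumption.
  + rewrite <- h, <- Rmult_assoc, is_sign_sqr by exact he; ring.
Qed.

(** Differentiate S^2 = (1 - z^2) / kappa in two ways and cancel 2 S s1 z, nonzero because z > 0. *)
Lemma profile_drho kappa eps m b z z1 lo hi U rho s1 s :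
  kappa <> 0 -> is_sign s1 -> determined_by kappa eps m b z (interval lo hi) U ->
  interval lo hi s -> is_derive z s (z1 s) -> ex_derive rho s ->
  polar_radius kappa (rho s) ->
  (forall u, interval lo hi u -> sn kappa (rho u) ^ 2 = radius2 eps m b U u) ->
  Derive (sn kappa) (rho s) = s1 * z s ->
  is_derive rho s (- s1 * z1 s / (kappa * sn kappa (rho s))).
Proof.
intros hk hs1 hU hs hz hrho hpol hsn hD.
destruct hrho as [r hr].
replace (- s1 * z1 s / (kappa * sn kappa (rho s))) with r; [exact hr|].
destruct (is_derive_sn kappa (rho s) hk) as [hS _].
assert (h1 : is_derive (fun u => sn kappa (rho u) ^ 2) s
  (2 * sn kappa (rho s) * (s1 * z s) * r)).
{ rewrite <- hD.
  assert (hc : is_derive (fun u => sn kappa (rho u)) s (r * Derive (sn kappa) (rho s)))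
    by (now apply (is_derive_comp (sn kappa) rho)).
  generalize (is_derive_pow _ 2 s _ hc); simpl INR; simpl Nat.pred.
  now replace ((1 + 1) * (r * Derive (sn kappa) (rho s)) * sn kappa (rho s) ^ 1)
    with (2 * sn kappa (rho s) * Derive (sn kappa) (rho s) * r) by ring. }
assert (h2 : is_derive (fun u => sn kappa (rho u) ^ 2) s (- (2 * z s * z1 s) / kappa)).
{ apply is_derive_ext_loc with (f := fun u => (1 - z u ^ 2) / kappa).
  - apply (locally_on lo hi) with (2 := hs); intros u hu.
    rewrite hsn by exact hu; symmetry.
    now apply (determined_by_sqr _ _ _ _ _ _ _ _ u hk hU hu).
  - auto_derive; [now exists (z1 s)|].
    replace (Derive (fun u : R => z u) s) with (z1 s)
      by (symmetry; now apply is_derive_unique).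
    field; exact hk. }
apply is_derive_unique in h1; apply is_derive_unique in h2; rewrite h1 in h2.
pose proof (sn_pos _ _ hk hpol) as hSpos.
destruct (determined_by_sqr _ _ _ _ _ _ _ _ s hk hU hs) as [hzpos _].
apply Rmult_eq_reg_l with (2 * sn kappa (rho s) * (s1 * z s)).
- rewrite h2; destruct hs1 as [-> | ->]; field; lra.
- destruct hs1 as [-> | ->]; nra.
Qed.

(* With [q = S ^ 2], [w = I0 + 2 H z / kappa] and [mu = m U], the numerator of the mean
   curvature exceeds [2 H mu ^ 3] by a multiple of [z1 ^ 2 / kappa ^ 2 + eps w ^ 2 - q],
   which is the first-order equation for [z]. *)
Lemma cmc_numerator kappa eps b H w S mu z z1 s1 s2 :
  kappa <> 0 -> is_sign eps -> is_sign s1 -> is_sign s2 -> S <> 0 -> mu <> 0 ->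
  mu ^ 2 = S ^ 2 + eps * b ^ 2 ->
  z1 ^ 2 / kappa ^ 2 + eps * w ^ 2 - S ^ 2 = 0 ->
  let C := s1 * z in
  let r1 := - s1 * z1 / (kappa * S) in
  let r2 := - s1 / kappa
    * ((- kappa * z - 2 * eps * H * kappa * w) / S - z1 * (C * r1) / S ^ 2) in
  let t1 := s2 * (w * mu / S ^ 2) in
  let t2 := s2 * (2 * H * z1 / kappa * mu / S ^ 2 + w * (- z * z1 / (kappa * mu)) / S ^ 2
    - 2 * w * mu * (C * r1) / S ^ 3) in
  (S * t1 * r2 - S * r1 * t2) * (S ^ 2 + eps * b ^ 2)
  - 2 * eps * b ^ 2 * C * r1 ^ 2 * t1
  - S ^ 2 * C * t1 * (r1 ^ 2 + eps * t1 ^ 2)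
  = 2 * (s1 * s2 * H) * mu ^ 3.
Proof.
intros hk he hs1 hs2 hS hmu eb ho C r1 r2 t1 t2.
(* Eliminating b through mu^2 = S^2 + eps b^2 leaves an identity in independent variables, which
   [field] can check. *)
rewrite <- eb.
replace (2 * eps * b ^ 2) with (2 * (mu ^ 2 - S ^ 2)) by lra.
apply Rminus_diag_uniq.
transitivity (s1 * s2 * mu ^ 3 * (2 * H / S ^ 2 - w * z / S ^ 4)
  * (z1 ^ 2 / kappa ^ 2 + eps * w ^ 2 - S ^ 2)); [|rewrite ho; ring].
unfold t2, t1, r2, r1, C; clear - hk he hs1 hs2 hS hmu.
destruct he as [-> | ->], hs1 as [-> | ->], hs2 as [-> | ->]; field; auto.
Qed.

(** * Curvature, first integral and metric of the reconstructed surface *)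

Lemma abs_sign m : m <> 0 -> exists sm, is_sign sm /\ Rabs m = sm * m.
Proof.
intros hm; destruct (Rle_dec 0 m) as [h|h].
- exists 1; split; [now left|]; rewrite Rabs_pos_eq; lra.
- exists (-1); split; [now right|]; rewrite Rabs_left; lra.
Qed.

(** With w = I + 2 H z / kappa, the first integral is t' S^2 / W = sm s2 w, and z = s1 sn'(rho). So
    I acquires sm s2, and H the further factor s1. *)
Lemma signed_profile_cmc kappa eps m b eta H I0 z z1 lo hi U rho t Th s1 s2 sm :
  kappa <> 0 -> is_sign eps -> m <> 0 -> cmc_ode kappa eps H I0 z z1 ->
  determined_by kappa eps m b z (interval lo hi) U ->
  is_sign s1 -> is_sign s2 -> is_sign sm -> Rabs m = sm * m ->
  (forall s, interval lo hi s ->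
    polar_radius kappa (rho s) /\
    sn kappa (rho s) ^ 2 = radius2 eps m b U s /\
    ex_derive rho s /\ Derive (sn kappa) (rho s) = s1 * z s /\
    is_derive t s (s2 * (I0 + 2 * H * z s / kappa) * (m * U s / radius2 eps m b U s)) /\
    is_derive Th s (b * (s2 * (I0 + 2 * H * z s / kappa))
      / (m * U s * radius2 eps m b U s))) ->
  constant_mean_curvature kappa eps (interval lo hi)
    (profile_surface m b eta rho t Th)
    (fun s _ => helicoidal_normal kappa eps b rho t s) (sm * s1 * s2 * H) /\
  first_integral kappa eps b (interval lo hi) rho t (sm * s1 * s2 * H) (sm * s2 * I0).
Proof.
intros hk he hm ho hU hs1 hs2 hsm hab hp.
set (w := fun s => I0 + 2 * H * z s / kappa) in *.
set (S := fun s => sn kappa (rho s)) in *.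
set (r1 := fun s => - s1 * z1 s / (kappa * S s)).
set (r2 := fun s => - s1 / kappa
    * ((- kappa * z s - 2 * eps * H * kappa * w s) / S s
       - z1 s * (s1 * z s * r1 s) / S s ^ 2)).
set (t1 := fun s => s2 * (w s * (m * U s) / S s ^ 2)).
set (t2 := fun s => s2 * (2 * H * z1 s / kappa * (m * U s) / S s ^ 2
    + w s * (- z s * z1 s / (kappa * (m * U s))) / S s ^ 2
    - 2 * w s * (m * U s) * (s1 * z s * r1 s) / S s ^ 3)).
set (h1 := fun s => b * (s2 * w s) / (m * U s * S s ^ 2)).
assert (hpos : forall s, interval lo hi s -> 0 < S s /\ 0 < U s /\ 0 < z s).
{ intros s hs; destruct (hp s hs) as [hpol _]; split; [|split].
  - now apply sn_pos.
  - apply (hU s hs).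
  - apply (determined_by_sqr _ _ _ _ _ _ _ _ s hk hU hs). }
assert (dr : forall s, interval lo hi s -> is_derive rho s (r1 s)).
{ intros s hs; destruct (hp s hs) as [hpol [_ [hex [hC _]]]].
  apply (profile_drho kappa eps m b z z1 lo hi U rho s1 s); auto; [apply ho|].
  intros u hu; apply (hp u hu). }
assert (dS : forall s, interval lo hi s -> is_derive S s (s1 * z s * r1 s)).
{ intros s hs; destruct (hp s hs) as [_ [_ [_ [hC _]]]]; rewrite <- hC, Rmult_comm.
  apply (is_derive_comp (sn kappa) rho); [now apply is_derive_sn|now apply dr]. }
assert (dU : forall s, interval lo hi s ->
  is_derive U s (- (z s * z1 s) / (kappa * m ^ 2 * U s))).
{ intros s hs; apply (determined_by_derive _ eps _ b _ lo hi); auto; apply ho. }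
assert (dt : forall s, interval lo hi s -> is_derive t s (t1 s)).
{ intros s hs; destruct (hp s hs) as [_ [hS [_ [_ [ht _]]]]].
  replace (t1 s) with (s2 * w s * (m * U s / radius2 eps m b U s)); [exact ht|].
  unfold t1, S, Rdiv; rewrite hS; ring. }
assert (dh : forall s, interval lo hi s -> is_derive Th s (h1 s)).
{ intros s hs; destruct (hp s hs) as [_ [hS [_ [_ [_ hT]]]]].
  unfold h1, S; rewrite hS; exact hT. }
assert (dr1 : forall s, interval lo hi s -> is_derive r1 s (r2 s)).
{ intros s hs; destruct (hpos s hs) as [pS [pU pz]]; destruct (ho s) as [_ [dz1 _]].
  pose proof (dS s hs) as dSs; unfold r1; auto_derive.
  - repeat split; [eexists; exact dz1|eexists; exact dSs|].
    apply Rmult_integral_contrapositive_currified; lra.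
  - replace (Derive (fun u : R => z1 u) s)
      with (- kappa * z s - 2 * eps * H * (kappa * I0 + 2 * H * z s))
      by (symmetry; now apply is_derive_unique).
    replace (Derive (fun u : R => S u) s) with (s1 * z s * r1 s)
      by (symmetry; now apply is_derive_unique).
    unfold r2, w; field; split; lra. }
assert (hmu : forall s, interval lo hi s -> m * U s <> 0).
{ intros s hs; destruct (hpos s hs) as [pS [pU pz]].
  apply Rmult_integral_contrapositive_currified; lra. }
assert (dt1 : forall s, interval lo hi s -> is_derive t1 s (t2 s)).
{ intros s hs; destruct (hpos s hs) as [pS [pU pz]]; destruct (ho s) as [dz _].
  pose proof (dS s hs) as dSs; pose proof (dU s hs) as dUs; unfold t1, w; auto_derive.
  - repeat split; [eexists; exact dz|eexists; exact dUs|eexists; exact dSs|].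
    now apply Rmult_integral_contrapositive_currified; [|rewrite Rmult_1_r]; apply Rgt_not_eq.
  - replace (Derive (fun u : R => z u) s) with (z1 s)
      by (symmetry; now apply is_derive_unique).
    replace (Derive (fun u : R => U u) s) with (- (z s * z1 s) / (kappa * m ^ 2 * U s))
      by (symmetry; now apply is_derive_unique).
    replace (Derive (fun u : R => S u) s) with (s1 * z s * r1 s)
      by (symmetry; now apply is_derive_unique).
    unfold t2, w; field; repeat split; lra. }
assert (dh1 : forall s, interval lo hi s -> ex_derive h1 s).
{ intros s hs; destruct (hpos s hs) as [pS [pU pz]]; destruct (ho s) as [dz _].
  pose proof (dS s hs) as dSs; pose proof (dU s hs) as dUs; unfold h1, w; auto_derive.
  repeat split; [eexists; exact dz|eexists; exact dUs|eexists; exact dSs|].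
  apply Rmult_integral_contrapositive_currified; [now apply hmu|].
  now apply Rmult_integral_contrapositive_currified; [|rewrite Rmult_1_r]; apply Rgt_not_eq. }
assert (hmu2 : forall s, interval lo hi s -> (m * U s) ^ 2 = S s ^ 2 + eps * b ^ 2).
{ intros s hs; destruct (hp s hs) as [_ [hS _]]; unfold S; rewrite hS; unfold radius2; ring. }
assert (hode : forall s, interval lo hi s ->
  z1 s ^ 2 / kappa ^ 2 + eps * w s ^ 2 - S s ^ 2 = 0).
{ intros s hs; destruct (hp s hs) as [_ [hS _]]; unfold S; rewrite hS.
  destruct (determined_by_sqr _ _ _ _ _ _ _ _ s hk hU hs) as [_ ->].
  destruct (ho s) as [_ [_ ->]]; unfold w; field; exact hk. }
assert (hW : forall s, interval lo hi s -> W2 kappa eps b rho t s = (m * U s) ^ 2).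
{ intros s hs; unfold W2; destruct (hpos s hs) as [pS [pU pz]].
  rewrite (is_derive_unique _ _ _ (dr s hs)), (is_derive_unique _ _ _ (dt s hs)).
  fold (S s); specialize (hode s hs); specialize (hmu2 s hs).
  (* Collecting the terms in r1^2 gives W^2 = mu^2 (r1^2 + eps w^2 / S^2) with mu = m U, and the
     bracket is 1 by [hode]. *)
  transitivity (z1 s ^ 2 / kappa ^ 2 / S s ^ 2 * (m * U s) ^ 2
    + eps * w s ^ 2 * (m * U s) ^ 2 / S s ^ 2).
  - rewrite hmu2 at 1; unfold r1, t1.
    destruct hs1 as [-> | ->], hs2 as [-> | ->]; field; split; lra.
  - replace (z1 s ^ 2 / kappa ^ 2) with (S s ^ 2 - eps * w s ^ 2) by lra.
    field; lra. }
assert (hsW : forall s, interval lo hi s ->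
  sqrt (W2 kappa eps b rho t s) = sm * (m * U s)).
{ intros s hs; rewrite hW, <- Rsqr_pow2, sqrt_Rsqr_abs, Rabs_mult, hab by exact hs.
  rewrite (Rabs_pos_eq (U s)); [ring|]; destruct (hpos s hs); lra. }
assert (hmupos : forall s, interval lo hi s -> 0 < (m * U s) ^ 2).
{ intros s hs; rewrite <- Rsqr_pow2; apply Rlt_0_sqr; now apply hmu. }
split.
- apply (profile_surface_cmc kappa eps m b eta _ lo hi rho t Th r1 t1 h1 r2 t2 (Derive h1));
    auto.
  + intros s hs; split; [apply (hp s hs)|].
    assert (dh2 : is_derive h1 s (Derive h1 s)) by now apply Derive_correct, dh1.
    auto 7.
  + intros s hs; rewrite hW by exact hs; fold (S s); rewrite <- hmu2 by exact hs.
    split; now apply hmupos.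
  + intros s hs; cbv zeta; destruct (hp s hs) as [_ [_ [_ [hC _]]]].
    destruct (hpos s hs) as [pS [pU pz]].
    rewrite hC, hsW by exact hs; fold (S s).
    transitivity (2 * (s1 * s2 * H) * (m * U s) ^ 3);
      [|destruct hsm as [-> | ->]; ring].
    apply (cmc_numerator kappa eps b H (w s) (S s) (m * U s) (z s) (z1 s) s1 s2);
      auto; lra.
- intros s hs; rewrite hsW, (is_derive_unique _ _ _ (dt s hs)) by exact hs.
  unfold int_sn; destruct (hp s hs) as [_ [_ [_ [hC _]]]]; rewrite hC.
  destruct (hpos s hs) as [pS [pU pz]]; fold (S s); unfold t1, w.
  destruct hs1 as [-> | ->], hs2 as [-> | ->], hsm as [-> | ->];
    field; repeat split; lra.
Qed.

(** For each s the map from v to theta is an affine bijection of the line, so the image is unchanged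
    when theta is the parameter. *)
Lemma profile_surface_helicoidal m b eta lo hi rho t Th :
  m <> 0 -> helicoidal b (interval lo hi) (profile_surface m b eta rho t Th).
Proof.
intros hm; exists rho, t; intros p; split.
- intros [s [v [hs <-]]]; now exists s, (v / m + eta * Th s).
- intros [s [th [hs <-]]]; exists s, (m * (th - eta * Th s)); split; [exact hs|].
  unfold profile_surface, screw_surface.
  now replace (m * (th - eta * Th s) / m + eta * Th s) with th by (field; exact hm).
Qed.

(** F is a multiple of b R0 (eta + eps), which singles out eta = - eps. Then E becomes rho'^2 + eps
    R0^2 / q, with q the squared radius, and the two radicands are made to sum to 1 in this way. *)
Lemma profile_natural_metric kappa eps m b z lo hi U rho R0 t Th :
  kappa <> 0 -> is_sign eps -> m <> 0 ->
  determined_by kappa eps m b z (interval lo hi) U ->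
  profile kappa eps m b (interval lo hi) U rho R0 t Th ->
  natural_metric kappa eps (interval lo hi) U (profile_surface m b (- eps) rho t Th).
Proof.
intros hk he hm hU [_ psn prho pR0 pt pth] s v hs.
destruct (prho s hs) as [hex hr2]; destruct (pR0 s hs) as [_ hR].
pose proof (profile_surface_d1 m b (- eps) rho t Th s v _ _ _ (Derive_correct _ _ hex)
  (pt s hs) (pth s hs)) as D1.
set (a1 := mkvec _ _ _) in D1; set (a2 := mkvec 0 (/ m) (b * / m)).
set (X := profile_surface m b (- eps) rho t Th) in *.
assert (E1 : forall i, Defs.d1 X s v i = a1 i) by (intros i; apply is_derive_unique, D1).
assert (E2 : forall i, Defs.d2 X s v i = a2 i)
  by (intros i; apply is_derive_unique, profile_surface_d2).
destruct (hU s hs) as [pU [pq [pz _]]].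
unfold ffE, ffF, ffG; rewrite (inner_ext _ _ _ _ _ a1 a1 E1 E1),
  (inner_ext _ _ _ _ _ a1 a2 E1 E2), (inner_ext _ _ _ _ _ a2 a2 E2 E2).
rewrite !inner_eq; change (X s v Rho) with (rho s); rewrite psn by exact hs.
assert (hb : eps * b ^ 2 = m ^ 2 * U s ^ 2 - radius2 eps m b U s)
  by (unfold radius2; ring).
unfold a1, a2; cbn [mkvec].
assert (hsum : Derive rho s ^ 2 + eps * R0 s ^ 2 / radius2 eps m b U s = 1).
{ rewrite hr2, hR; unfold drho_radicand, R0_radicand.
  destruct he as [-> | ->]; field; lra. }
set (q := radius2 eps m b U s) in *; clearbody q.
repeat split.
- transitivity (Derive rho s ^ 2
    + eps * R0 s ^ 2 / q * ((q * (eps * b ^ 2) + (m ^ 2 * U s ^ 2 - eps * b ^ 2) ^ 2)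
        / (q * (m ^ 2 * U s ^ 2)))).
  + destruct he as [-> | ->]; field; repeat split; lra || assumption.
  + rewrite hb; rewrite <- hsum; field; repeat split; lra || assumption.
- transitivity (eps * b * R0 s / q * (/ m) / (m * U s)
    * (m ^ 2 * U s ^ 2 - q - eps * b ^ 2)).
  + destruct he as [-> | ->]; field; repeat split; lra || assumption.
  + rewrite hb; ring.
- transitivity ((q + eps * b ^ 2) / m ^ 2); [field; exact hm|].
  rewrite hb; field; exact hm.
Qed.

(** * Signs of a given profile and existence of one *)

Lemma profile_signs kappa eps m b H I0 z z1 lo hi U rho R0 t Th :
  kappa <> 0 -> is_sign eps -> m <> 0 -> Rbar_lt lo hi -> cmc_ode kappa eps H I0 z z1 ->
  determined_by kappa eps m b z (interval lo hi) U ->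
  profile kappa eps m b (interval lo hi) U rho R0 t Th ->
  exists s1 s2, is_sign s1 /\ is_sign s2 /\
    forall s, interval lo hi s ->
      Derive (sn kappa) (rho s) = s1 * z s /\ R0 s = s2 * (I0 + 2 * H * z s / kappa).
Proof.
intros hk he hm hlt ho hU [_ psn prho pR0 _ _].
assert (dz : forall s, is_derive z s (z1 s)) by (intros s; apply (ho s)).
destruct (sign_determination lo hi (fun s => Derive (sn kappa) (rho s)) z z1)
  as [s1 [hs1 h1]]; auto.
- intros s hs; destruct (is_derive_sn kappa (rho s) hk) as [_ [_ ->]].
  rewrite psn by exact hs.
  destruct (determined_by_sqr _ _ _ _ _ _ _ _ s hk hU hs) as [_ ->]; field; exact hk.
- intros s hs; destruct (is_derive_sn kappa (rho s) hk) as [_ [h _]].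
  apply (ex_derive_comp (Derive (sn kappa)) rho); [eexists; exact h|].
  now apply prho.
- intros s hs; destruct (determined_by_sqr _ _ _ _ _ _ _ _ s hk hU hs) as [h _]; nra.
- set (w := fun s => I0 + 2 * H * z s / kappa).
  assert (hsq : forall s, interval lo hi s -> R0 s ^ 2 = w s ^ 2).
  { intros s hs; destruct (pR0 s hs) as [_ ->].
    now apply (determined_by_radicands kappa eps m b H I0 z z1 lo hi). }
  enough (h2 : exists s2, is_sign s2 /\ forall s, interval lo hi s -> R0 s = s2 * w s).
  { destruct h2 as [s2 [hs2 h2]]; exists s1, s2; auto. }
  (* For H = 0, w is the constant I; if that is 0 as well, [sign_determination] does not apply, but
     R0 = 0 and either sign serves. *)
  destruct (Req_dec H 0) as [hH|hH]; [destruct (Req_dec I0 0) as [hI|hI]|].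
  + exists 1; split; [now left|]; intros s hs; specialize (hsq s hs); unfold w in *.
    rewrite hH, hI in *; replace (0 + 2 * 0 * z s / kappa) with 0 in * by (field; exact hk).
    nra.
  + apply (sign_determination lo hi R0 w (fun s => 2 * H * z1 s / kappa)); auto.
    * intros s hs; apply (pR0 s hs).
    * intros s _; unfold w; auto_derive; [eexists; apply dz|].
      replace (Derive (fun u : R => z u) s) with (z1 s)
        by (symmetry; apply is_derive_unique, dz).
      field; exact hk.
    * intros s _; unfold w; rewrite hH.
      replace (I0 + 2 * 0 * z s / kappa) with I0 by (field; exact hk).
      assert (0 < I0 ^ 2) by (rewrite <- Rsqr_pow2; now apply Rlt_0_sqr).
      pose proof (pow2_ge_0 (2 * 0 * z1 s / kappa)); lra.
  + apply (sign_determination lo hi R0 w (fun s => 2 * H * z1 s / kappa)); auto.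
    * intros s hs; apply (pR0 s hs).
    * intros s _; unfold w; auto_derive; [eexists; apply dz|].
      replace (Derive (fun u : R => z u) s) with (z1 s)
        by (symmetry; apply is_derive_unique, dz).
      field; exact hk.
    * (* A double zero of [w] would be a zero of [z1] and of the radius. *)
      intros s hs; pose proof (pow2_ge_0 (w s)); pose proof (pow2_ge_0 (2 * H * z1 s / kappa)).
      destruct (Req_dec (w s ^ 2 + (2 * H * z1 s / kappa) ^ 2) 0) as [h0|h0]; [|lra].
      exfalso.
      assert (hw : kappa * I0 + 2 * H * z s = 0).
      { replace (kappa * I0 + 2 * H * z s) with (kappa * w s)
          by (unfold w; field; exact hk).
        rewrite (Rsqr_0_uniq (w s)) by (rewrite Rsqr_pow2; lra); ring. }
      assert (hz1 : z1 s = 0).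
      { replace (z1 s) with (kappa / (2 * H) * (2 * H * z1 s / kappa))
          by (field; now split).
        rewrite (Rsqr_0_uniq (2 * H * z1 s / kappa)) by (rewrite Rsqr_pow2; lra); ring. }
      destruct (ho s) as [_ [_ e]]; rewrite hw, hz1 in e.
      destruct (determined_by_sqr _ _ _ _ _ _ _ _ s hk hU hs) as [_ hq].
      destruct (hU s hs) as [_ [hpos _]]; rewrite hq in hpos.
      replace ((1 - z s ^ 2) / kappa) with (kappa * (1 - z s ^ 2) / kappa ^ 2) in hpos
        by (field; exact hk).
      replace (kappa * (1 - z s ^ 2)) with 0 in hpos by lra.
      unfold Rdiv in hpos; lra.
Qed.

(** Inverting sn' at z fixes the sign of sn'(rho); the sign [sm] of R0 stays free so that it can be
    matched to that of m. *)
Lemma profile_exists kappa eps m b H I0 z z1 lo hi U sm :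
  kappa <> 0 -> is_sign eps -> m <> 0 -> is_sign sm -> Rbar_lt lo hi ->
  cmc_ode kappa eps H I0 z z1 ->
  determined_by kappa eps m b z (interval lo hi) U ->
  exists rho t Th,
    profile kappa eps m b (interval lo hi) U rho
      (fun s => sm * (I0 + 2 * H * z s / kappa)) t Th /\
    forall s, interval lo hi s -> Derive (sn kappa) (rho s) = z s.
Proof.
intros hk he hm hsm hlt ho hU.
assert (dz : forall s, is_derive z s (z1 s)) by (intros s; apply (ho s)).
set (w := fun s => sm * (I0 + 2 * H * z s / kappa)).
assert (hw : forall s, ex_derive w s).
{ intros s; unfold w; auto_derive; eexists; apply dz. }
assert (hUd : forall s, interval lo hi s -> ex_derive U s).
{ intros s hs; eexists; apply (determined_by_derive kappa eps m b z lo hi U s (z1 s)); auto. }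
assert (hne : forall s, interval lo hi s -> U s <> 0 /\ radius2 eps m b U s <> 0).
{ intros s hs; destruct (hU s hs) as [h [h' _]]; split; lra. }
destruct (antiderivative_on_interval lo hi
  (fun s => w s * (m * U s / radius2 eps m b U s)) hlt) as [t ht].
{ intros s hs; apply (@ex_derive_continuous R_AbsRing R_NormedModule).
  specialize (hw s); specialize (hUd s hs); destruct (hne s hs) as [_ h].
  unfold radius2 in *; auto_derive; auto. }
destruct (antiderivative_on_interval lo hi
  (fun s => b * w s / (m * U s * radius2 eps m b U s)) hlt) as [Th hTh].
{ intros s hs; apply (@ex_derive_continuous R_AbsRing R_NormedModule).
  specialize (hw s); specialize (hUd s hs); destruct (hne s hs) as [h' h].
  unfold radius2 in *; auto_derive; repeat split; auto. }
set (rho := fun s => radius_of_cs kappa (z s)).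
assert (spec : forall s, interval lo hi s ->
  polar_radius kappa (rho s) /\ sn kappa (rho s) ^ 2 = radius2 eps m b U s /\
  Derive (sn kappa) (rho s) = z s /\ ex_derive (radius_of_cs kappa) (z s)).
{ intros s hs; destruct (determined_by_sqr _ _ _ _ _ _ _ _ s hk hU hs) as [hz hq].
  rewrite hq; apply radius_of_cs_spec; auto; rewrite <- hq.
  apply (hU s hs). }
assert (drho : forall s, interval lo hi s -> ex_derive rho s).
{ intros s hs; apply (ex_derive_comp (radius_of_cs kappa) z); [now apply spec|].
  eexists; apply dz. }
exists rho, t, Th; split; [|intros s hs; now apply spec].
split; [| | | |exact ht|exact hTh].
- intros s hs; apply (spec s hs).
- intros s hs; apply (spec s hs).
- intros s hs; split; [exact (drho s hs)|]; destruct (spec s hs) as [hp [hS [hC _]]].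
  assert (d : is_derive rho s (- 1 * z1 s / (kappa * sn kappa (rho s)))).
  { apply (profile_drho kappa eps m b z z1 lo hi U rho 1 s hk); auto; [now left| |].
    - intros u hu; apply (spec u hu).
    - rewrite hC; ring. }
  rewrite (is_derive_unique _ _ _ d).
  destruct (determined_by_radicands _ _ _ _ _ _ _ _ _ _ _ s hk he hm ho hU hs) as [-> _].
  rewrite <- hS; field; split; [|exact hk].
  pose proof (sn_pos _ _ hk hp); lra.
- intros s hs; split; [apply hw|].
  destruct (determined_by_radicands _ _ _ _ _ _ _ _ _ _ _ s hk he hm ho hU hs) as [_ ->].
  unfold w; destruct hsm as [-> | ->]; ring.
Qed.

Theorem theorem4 (kappa eps H I0 s0 A c : R) (z : R -> R)
  (hkappa : kappa <> 0)
  (heps : eps = 1 \/ eps = -1)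
  (hA : A = 4 * H ^ 2 * eps + kappa)
  (hc : A <> 0 ->
    0 <= c /\ c ^ 2 = Rabs (kappa / A ^ 2 * (A - kappa ^ 2 * I0 ^ 2 * eps))) :
  (0 < A ->
    forall (b : R) (lo hi : Rbar) (f : R -> R),
      graph_with_first_integral kappa eps b H I0 lo hi f ->
      0 < kappa * (A - kappa ^ 2 * I0 ^ 2 * eps))
  /\
  (A = 0 -> H * kappa * I0 = 0 ->
    forall (b : R) (lo hi : Rbar) (f : R -> R),
      graph_with_first_integral kappa eps b H I0 lo hi f ->
      0 < kappa * (1 - kappa * I0 ^ 2 * eps))
  /\
  ((A < 0 /\ kappa * (A - kappa ^ 2 * I0 ^ 2 * eps) < 0 /\
      forall s, z s = c * sinh (sqrt (- A) * (s - s0)) - 2 * H * kappa * I0 * eps / A)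
   \/
   (A < 0 /\ 0 < kappa * (A - kappa ^ 2 * I0 ^ 2 * eps) /\
      forall s, z s = c * cosh (sqrt (- A) * (s - s0)) - 2 * H * kappa * I0 * eps / A)
   \/
   (0 < A /\ 0 < kappa * (A - kappa ^ 2 * I0 ^ 2 * eps) /\
      forall s, z s = c * sin (sqrt A * (s - s0)) - 2 * H * kappa * I0 * eps / A)
   \/
   (A = 0 /\ H * kappa * I0 = 0 /\ 0 < kappa * (1 - kappa * I0 ^ 2 * eps) /\
      forall s, z s = sqrt (kappa * (1 - kappa * I0 ^ 2 * eps)) * (s - s0))
   \/
   (A = 0 /\ H * kappa * I0 <> 0 /\
      forall s, z s = - (1 / (4 * H * kappa * I0 * eps)) *
        ((4 * H * kappa * I0 * eps) ^ 2 * (1 / 4 * (s - s0) ^ 2)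
         - kappa * (1 - kappa * I0 ^ 2 * eps))) ->
   forall (m b eta : R) (lo hi : Rbar) (U : R -> R),
     m <> 0 -> is_sign eta -> Rbar_lt lo hi ->
     determined_by kappa eps m b z (interval lo hi) U ->
     (forall rho R0 t Th : R -> R,
        profile kappa eps m b (interval lo hi) U rho R0 t Th ->
        helicoidal b (interval lo hi) (profile_surface m b eta rho t Th) /\
        (eta = - eps ->
           natural_metric kappa eps (interval lo hi) U
             (profile_surface m b eta rho t Th)) /\
        exists sigma tau : R,
          is_sign sigma /\ is_sign tau /\
          ((forall s, interval lo hi s -> Derive (sn kappa) (rho s) = z s) ->
             tau = sigma) /\
          constant_mean_curvature kappa eps (interval lo hi)
            (profile_surface m b eta rho t Th)
            (fun s _ => helicoidal_normal kappa eps b rho t s) (tau * H) /\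
          first_integral kappa eps b (interval lo hi) rho t (tau * H) (sigma * I0))
     /\
     (exists rho R0 t Th : R -> R,
        profile kappa eps m b (interval lo hi) U rho R0 t Th /\
        (forall s, interval lo hi s -> Derive (sn kappa) (rho s) = z s) /\
        constant_mean_curvature kappa eps (interval lo hi)
          (profile_surface m b eta rho t Th)
          (fun s _ => helicoidal_normal kappa eps b rho t s) H /\
        first_integral kappa eps b (interval lo hi) rho t H I0)).
Proof.
assert (disc : forall b lo hi f, graph_with_first_integral kappa eps b H I0 lo hi f ->
  exists x, 0 < kappa * (1 - x ^ 2) - eps * (kappa * I0 + 2 * H * x) ^ 2)
  by (intros; eapply first_integral_discriminant_pos; eassumption).
split; [|split].
- intros hA0 b lo hi f hf; destruct (disc b lo hi f hf) as [x hx].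
  (* Completing the square: A times the positive value at x, plus a square. *)
  assert (e : kappa * (A - kappa ^ 2 * I0 ^ 2 * eps)
    = A * (kappa * (1 - x ^ 2) - eps * (kappa * I0 + 2 * H * x) ^ 2)
      + (A * x + 2 * H * kappa * I0 * eps) ^ 2).
  { rewrite hA; destruct heps as [-> | ->]; ring. }
  rewrite e; pose proof (Rmult_lt_0_compat _ _ hA0 hx).
  pose proof (pow2_ge_0 (A * x + 2 * H * kappa * I0 * eps)); lra.
- intros hA0 hd b lo hi f hf; destruct (disc b lo hi f hf) as [x hx].
  (* The quadratic has leading coefficient - A and linear coefficient - 4 eps H kappa I; here both
     vanish, so it equals its constant term. *)
  replace (kappa * (1 - kappa * I0 ^ 2 * eps))
    with (kappa * (1 - x ^ 2) - eps * (kappa * I0 + 2 * H * x) ^ 2 + A * x ^ 2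
      + 4 * eps * x * (H * kappa * I0)) by (rewrite hA; ring).
  rewrite hA0, hd; lra.
- intros hz m b eta lo hi U hm heta hlt hU.
  destruct (cmc_ode_of_explicit_form kappa eps H I0 s0 A c z heps hA) as [z1 ho]; auto.
  { intros h; now apply hc. }
  destruct (abs_sign m hm) as [sm [hsm hab]].
  split.
  + intros rho R0 t Th hp; split; [now apply profile_surface_helicoidal|split].
    { intros ->; now apply (profile_natural_metric kappa eps m b z lo hi U rho R0). }
    destruct (profile_signs kappa eps m b H I0 z z1 lo hi U rho R0 t Th)
      as [s1 [s2 [hs1 [hs2 hs]]]]; auto.
    exists (sm * s2), (sm * s1 * s2).
    split; [now apply is_sign_mult|split; [now repeat apply is_sign_mult|split]].
    (* One point suffices: z > 0 there, so sn'(rho) = z forces s1 = 1. *)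
    { intros hD; destruct (interval_inhabited lo hi hlt) as [s hss].
      destruct (hs s hss) as [h _]; rewrite (hD s hss) in h.
      destruct (determined_by_sqr _ _ _ _ _ _ _ _ s hkappa hU hss) as [hzpos _].
      destruct hs1 as [-> | ->]; [ring|exfalso; lra]. }
    apply (signed_profile_cmc kappa eps m b eta H I0 z z1 lo hi U rho t Th s1 s2 sm); auto.
    intros s hss; destruct hp as [p1 p2 p3 p4 p5 p6]; destruct (hs s hss) as [h1 h2].
    specialize (p1 s hss); specialize (p2 s hss); destruct (p3 s hss) as [p3' _].
    specialize (p5 s hss); specialize (p6 s hss); rewrite h2 in p5, p6; auto 8.
  + destruct (profile_exists kappa eps m b H I0 z z1 lo hi U sm) as [rho [t [Th [hp hD]]]];
      auto.
    exists rho, (fun s => sm * (I0 + 2 * H * z s / kappa)), t, Th.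
    split; [exact hp|split; [exact hD|]].
    (* R0 carries the sign of m, so s1 = 1 and s2 = sm, and both products of signs equal 1. *)
    assert (e : sm * sm = 1) by now apply is_sign_sqr.
    enough (h : constant_mean_curvature kappa eps (interval lo hi)
        (profile_surface m b eta rho t Th)
        (fun s _ => helicoidal_normal kappa eps b rho t s) (sm * 1 * sm * H) /\
      first_integral kappa eps b (interval lo hi) rho t (sm * 1 * sm * H) (sm * sm * I0))
      by (now rewrite Rmult_1_r, e, !Rmult_1_l in h).
    apply (signed_profile_cmc kappa eps m b eta H I0 z z1 lo hi U rho t Th 1 sm sm);
      auto; [now left|].
    intros s hss; destruct hp as [p1 p2 p3 _ p5 p6].
    specialize (p1 s hss); specialize (p2 s hss); destruct (p3 s hss) as [p3' _].
    rewrite Rmult_1_l; specialize (hD s hss); specialize (p5 s hss); auto 8.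
Qed.
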